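(* For $\omega\in\mathfrak{B}_n$ chosen uniformly at random, the random variable $\beta/n^3=\beta(\omega)/n^3$ converges in distribution, as $n\to\infty$, to $\frac12L_2L_3(L_2+L_3)$. More precisely, for fixed $0\le i_0<i_1\le 1$ and $0\le j_0<j_1\le 1$, and intervals $I=(ni_0,ni_1)\subseteq(0,n)$, $J=(nj_0,nj_1)\subseteq(0,n)$, as $n\to\infty$, $$\mathbb{P}\left(\ell_2(\omega)\in I,\ \ell_3(\omega)\in J\right)\to\int_{\substack{i_0<x_1<i_1\\ j_0<x_2<j_1\\ 0<x_1+x_2<1}}6(1-x_1-x_2)\,dA=\mathbb{P}\left[L_2\in(i_0,i_1),\,L_3\in(j_0,j_1)\right],$$ with error term of order $n^{-1}$ (that is, the difference between the left side and the limit is $O(n^{-1})$).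
   Context: $\mathfrak{S}_n$ is the set of permutations of $[n]=\{1,\dots,n\}$, in one-line notation. A reduction of $\omega\in\mathfrak{S}_n$ interchanges $\omega(i)$ and $\omega(j)$ for some $i<j$ with $\omega(i)>\omega(j)$. Bruhat order: $\pi\le\sigma$ if $\pi$ is obtained from $\sigma$ by a (possibly empty) sequence of reductions. $\mathfrak{B}_n\subseteq\mathfrak{S}_n$ is the set of bigrassmannian permutations (both $\omega$ and $\omega^{-1}$ have exactly one descent); equivalently $\omega=1\cdots a\,(b+1)\cdots c\,(a+1)\cdots b\,(c+1)\cdots n$ for a unique triple $0\le a<b<c\le n$. For such $\omega$, $\ell_2(\omega)=b-a$ and $\ell_3(\omega)=c-b$. $\beta(\omega)$ is the number of $\pi\in\mathfrak{B}_n$ with $\pi\le\omega$. Let $0<X<Y<Z<1$ be the increasing rearrangement of three independent uniformly random points of $(0,1)$; $L_1=X$, $L_2=Y-X$, $L_3=Z-Y$, $L_4=1-Z$. *)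

(* Defs.v *)
From HB Require Import structures.
From mathcomp Require Import all_boot all_order all_algebra all_fingroup.
From mathcomp Require Import all_classical all_reals all_analysis.

Set Implicit Arguments.
Unset Strict Implicit.
Unset Printing Implicit Defensive.

Import Order.TTheory GRing.Theory Num.Theory.
Import numFieldNormedType.Exports.

                                                                               
                                                                              
Section Permutations.
Variable n : nat.
Implicit Types w p s : 'S_n.

                                                                      
                                         
Definition reduction : rel 'S_n := fun s p =>
  [exists i : 'I_n, exists j : 'I_n,
    [&& (i < j)%N, (s j < s i)%N & p == (tperm i j * s)%g]].

Definition bruhat : rel 'S_n := fun p s => connect reduction s p.

Definition descents w : {set 'I_n} :=
  [set i : 'I_n | [exists j : 'I_n, (j == i.+1 :> nat) && (w j < w i)%N]].

Definition bigrassmannian : {set 'S_n} :=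
  [set w | (#|descents w| == 1) && (#|descents w^-1%g| == 1)].

Definition one_line w : seq nat := [seq val (w i) | i <- enum 'I_n].

                                                                         
                   
Definition is_block_triple w (t : 'I_n.+1 * 'I_n.+1 * 'I_n.+1) : bool :=
  let: (a, b, c) := t in
  [&& (a < b)%N, (b < c)%N &
      one_line w == iota 0 a ++ iota b (c - b) ++ iota a (b - a)
                    ++ iota c (n - c)].

                                                                 
Definition block_triple w : 'I_n.+1 * 'I_n.+1 * 'I_n.+1 :=
  odflt (ord0, ord0, ord0) [pick t | is_block_triple w t].

Definition ell2 w : nat := let: (a, b, _) := block_triple w in (b - a)%N.

Definition ell3 w : nat := let: (_, b, c) := block_triple w in (c - b)%N.

Definition beta w : nat := #|[set p in bigrassmannian | bruhat p w]|.

End Permutations.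

Local Open Scope classical_set_scope.
Local Open Scope ring_scope.

                                                                          
            
Definition unif_pr (R : realType) (T : finType) (A : {set T}) (E : pred T) : R :=
  #|[set x in A | E x]|%:R / #|A|%:R.

                                                                        
Definition cvg_in_distribution (R : realType) (F_ : nat -> R -> R)
    (F : R -> R) : Prop :=
  forall x, {for x, continuous F} -> F_ n x @[n --> \oo] --> F x.

Definition mutually_independent (R : realType) (d : measure_display)
    (T : measurableType d) (P : probability T R) (I : finType)
    (U : I -> {RV P >-> R}) : Prop :=
  forall (J : {set I}) (A : I -> set R), (forall i, measurable (A i)) ->
    P (\bigcap_(i in [set` J]) (U i @^-1` A i)) =
    (\prod_(i in J) P (U i @^-1` A i))%E.

Section Spacings.
Variables (R : realType) (T : Type) (U : 'I_3 -> T -> R).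

Definition order_stat (k : nat) (t : T) : R :=
  nth 0 (sort <=%R [seq U i t | i <- enum 'I_3]) k.

Definition L2 (t : T) : R := order_stat 1 t - order_stat 0 t.

Definition L3 (t : T) : R := order_stat 2 t - order_stat 1 t.

End Spacings.

(* Main.v *)
(**
A bigrassmannian permutation is a block permutation given by [a < b < c <= n].
The bounds [w k <= k + (b - a)] and [k <= w k + (c - b)] and the properties that
[w] fixes every point below [a] and every point from [c] on are inherited by
smaller permutations; conversely, shrinking either run of the block by one at
either end is a decrease in the Bruhat order.  Hence the bigrassmannian
permutations below [w] are the [a' < b' < c'] with [a <= a'], [c' <= c],
[b' - a' <= b - a] and [c' - b' <= c - b], and [2 * beta w = p * q * (p + q)]
with [p = ell2 w] and [q = ell3 w].

The law of [(ell2, ell3)] is compared with that of [(L2, L3)] by a coupling: cut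
[0, 1) into [n + 1] cells.  Each triple [a < b < c] and each ordering of the
three points determine an event of probability [(n + 1)^-3] on which the
spacings are [(b - a) / n] and [(c - b) / n] up to [2 / n], and these events are
disjoint and cover all but [O(1 / n)] of the space.  Convergence of [beta / n^3]
follows at continuity points.  Explicitly, the number of triples with
[p >= s] and [q >= t] is [C(n + 3 - s - t, 3)], so that the law of the spacings on
a rectangle is the alternating sum of [max(0, 1 - x - y)^3] over its corners,
which Fubini and two antiderivatives identify with the integral.
*)

Require Import Defs.
From HB Require Import structures.
From mathcomp Require Import all_boot all_order all_algebra all_fingroup.
From mathcomp Require Import all_classical all_reals all_analysis.
From mathcomp Require Import measurable_realfun zify ring lra.

Set Implicit Arguments.
Unset Strict Implicit.
Unset Printing Implicit Defensive.

Import Order.TTheory GRing.Theory Num.Theory.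
Import numFieldNormedType.Exports.

(** * Block form of bigrassmannian permutations *)

Section BlockPermutations.

(** Positions count from 0. The values from [b] on come first: a run of length [c - b] is raised by
    [b - a], and the next [b - a] entries are lowered by [c - b]. Working on [nat] leaves the case
    distinctions to linear arithmetic. *)
Definition block_fun (a b c x : nat) : nat :=
  if (x < a)%N then x else if (x < a + (c - b))%N then (x + (b - a))%N
  else if (x < c)%N then (x - (c - b))%N else x.

Variable n : nat.
Implicit Types w p s : 'S_n.

Definition is_block w a b c := forall x : 'I_n, w x = block_fun a b c x :> nat.

Lemma is_block_tripleP w (t : 'I_n.+1 * 'I_n.+1 * 'I_n.+1) :
  reflect [/\ (t.1.1 < t.1.2)%N, (t.1.2 < t.2)%N & is_block w t.1.1 t.1.2 t.2]
          (is_block_triple w t).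
Proof.
case: t => [[a b] c] /=; have cn : (c <= n)%N by rewrite -ltnS.
have iotaE m k i : nth 0%N (iota m k) i = if (i < k)%N then (m + i)%N else 0%N.
  by case: ltnP => ik; [rewrite nth_iota|rewrite nth_default ?size_iota].
apply: (iffP and3P) => -[ab bc]; last first.
  move=> wE; split=> //; apply/eqP; apply: (@eq_from_nth _ 0%N).
    rewrite size_map size_enum_ord !size_cat !size_iota; lia.
  move=> i; rewrite size_map size_enum_ord => iltn.
  rewrite (nth_map (Ordinal iltn)) ?size_enum_ord // (nth_ord_enum _ (Ordinal iltn)).
  rewrite /= wE /block_fun !nth_cat !size_iota /=.
  by rewrite !iotaE; repeat case: ifP; lia.
move=> /eqP wE; split=> // x.
have -> : w x = nth 0%N (one_line w) x :> nat.
  rewrite (nth_map x) ?size_enum_ord //; congr (val (w _)).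
  by rewrite nth_ord_enum.
have xn := ltn_ord x.
rewrite wE /block_fun !nth_cat !size_iota.
by rewrite !iotaE; repeat case: ifP; lia.
Qed.

Lemma is_block_inj w1 w2 a b c : is_block w1 a b c -> is_block w2 a b c -> w1 = w2.
Proof. by move=> w1E w2E; apply/permP => x; apply/val_inj; rewrite /= w1E w2E. Qed.

(** Inversion exchanges the lengths of the two runs. Through it, each argument about one run also
    serves for the other. *)
Lemma is_blockV w a b c : (a < b < c)%N -> (c <= n)%N ->
  is_block w a b c -> is_block w^-1%g a (a + (c - b)) c.
Proof.
move=> abc cn wE x; have := wE (w^-1%g x); rewrite permKV.
by rewrite /block_fun; have := ltn_ord x; repeat case: ifP; lia.
Qed.

Lemma block_exists a b c : (a < b < c)%N -> (c <= n)%N -> exists w, is_block w a b c.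
Proof.
move=> abc cn.
have fP (x : 'I_n) : (block_fun a b c x < n)%N.
  by have := ltn_ord x; rewrite /block_fun; repeat case: ifP; lia.
have fI : injective (fun x : 'I_n => Ordinal (fP x)).
  move=> x y [] /eqP; rewrite /block_fun => xy; apply/val_inj => /=.
  by move: xy; repeat case: ifP; lia.
by exists (perm fI) => x; rewrite permE.
Qed.

(** The triple can be read off: [a] is the first moved point, [b] its image, and [c] the first point
    after the moved ones. *)
Lemma is_block_unique w a b c a' b' c' :
  (a < b < c)%N -> (c <= n)%N -> (a' < b' < c')%N -> (c' <= n)%N ->
  is_block w a b c -> is_block w a' b' c' -> [/\ a = a', b = b' & c = c'].
Proof.
wlog aa' : a b c a' b' c' / (a <= a')%N.
  move=> H h1 h2 h3 h4 w1 w2; case: (leqP a a') => [|/ltnW] aa'; first exact: (H a b c).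
  by have [-> -> ->] := H a' b' c' a b c aa' h3 h4 h1 h2 w2 w1.
move=> abc cn abc' cn' w1 w2.
have E x : (x < n)%N -> block_fun a b c x = block_fun a' b' c' x.
  by move=> xn; rewrite -(w1 (Ordinal xn)) -(w2 (Ordinal xn)).
have E0 : a = a'.
  have an : (a < n)%N by lia.
  by move: (E a an); rewrite /block_fun; repeat case: ifP; lia.
subst a'.
have bb' : b = b'.
  have an : (a < n)%N by lia.
  by move: (E a an); rewrite /block_fun; repeat case: ifP; lia.
subst b'; split=> //.
have [cc|cc|//] := ltngtP c c'.
  have an : (c < n)%N by lia.
  by move: (E c an); rewrite /block_fun; repeat case: ifP; lia.
have an : (c' < n)%N by lia.
by move: (E c' an); rewrite /block_fun; repeat case: ifP; lia.
Qed.

Lemma descentP w (i : 'I_n) :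
  reflect (exists2 j : 'I_n, j = i.+1 :> nat & (w j < w i)%N) (i \in descents w).
Proof.
rewrite inE; apply: (iffP existsP) => [[j /andP[/eqP ? ?]]|[j ? ?]].
  by exists j.
by exists j; apply/andP; split=> //; apply/eqP.
Qed.

(** The only descent is the last position of the first run, [a + (c - b) - 1]. *)
Lemma block_card_descents w a b c : (a < b < c)%N -> (c <= n)%N ->
  is_block w a b c -> #|descents w| == 1%N.
Proof.
move=> abc cn wE.
have dn : ((a + (c - b)).-1 < n)%N by lia.
have dn' : ((a + (c - b)) < n)%N by lia.
apply/cards1P; exists (Ordinal dn); apply/setP => i; rewrite finset.in_set1.
apply/descentP/eqP => [[j ji]|->].
  rewrite !wE ji => H; apply/val_inj => /=.
  by move: H; rewrite /block_fun; repeat case: ifP; lia.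
exists (Ordinal dn') => /=; first lia.
by rewrite !wE /block_fun /=; repeat case: ifP; lia.
Qed.

Lemma block_bigrassmannian w a b c : (a < b < c)%N -> (c <= n)%N ->
  is_block w a b c -> w \in bigrassmannian n.
Proof.
move=> abc cn wE; rewrite inE (block_card_descents abc cn wE) /=.
by apply: (block_card_descents _ cn (is_blockV abc cn wE)); lia.
Qed.

Lemma increasing_away_from_descent w (d : 'I_n) (x y : 'I_n) :
  descents w = [set d] -> (x < y)%N -> (y <= d)%N || (d < x)%N -> (w x < w y)%N.
Proof.
move=> dw xy xyd.
have step (i j : 'I_n) : j = i.+1 :> nat -> i != d -> (w i < w j)%N.
  move=> ji id; rewrite ltnNge leq_eqVlt negb_or; apply/andP; split.
    apply/eqP => /val_inj/perm_inj ij; move: ji; rewrite ij; lia.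
  apply/negP => ij; move/negP: id; apply.
  by rewrite -finset.in_set1 -dw; apply/descentP; exists j.
elim: {y}(nat_of_ord y) {-2}y (erefl (nat_of_ord y)) xy xyd => [|m IH] y ym xy xyd.
  lia.
have mn : (m < n)%N by have := ltn_ord y; lia.
have yd : Ordinal mn != d by apply/eqP => /(congr1 val) /=; lia.
have sty := step (Ordinal mn) y ym yd.
move: xy; rewrite ym ltnS leq_eqVlt => /orP[/eqP xm|xm].
  by rewrite (_ : x = Ordinal mn) //; apply/val_inj.
by apply: ltn_trans sty; apply: IH => //=; lia.
Qed.

End BlockPermutations.

(** * Bigrassmannian permutations are block permutations *)

Section BigrassmannianBlocks.

(* [f] and [g] stand for a permutation and its inverse, extended to [nat], and
   [a] is the first moved point. *)
Lemma monotone_pieces_block (n a : nat) (f g : nat -> nat) :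
  (forall x, (x < n)%N -> (f x < n)%N) -> (forall x, (x < n)%N -> (g x < n)%N) ->
  (forall x, (x < n)%N -> f (g x) = x) -> (forall x, (x < n)%N -> g (f x) = x) ->
  (a < n)%N -> (forall x, (x < a)%N -> f x = x) -> (a < f a)%N -> (a < g a)%N ->
  (forall x y, (x < y < n)%N -> (y < g a)%N || (g a <= x)%N -> (f x < f y)%N) ->
  (forall x y, (x < y < n)%N -> (y < f a)%N || (f a <= x)%N -> (g x < g y)%N) ->
  (f a + (g a - a) <= n)%N /\
  forall x, (x < n)%N -> f x = block_fun a (f a) (f a + (g a - a)) x.
Proof.
move=> fn gn fgK gfK an fid afa aga finc ginc.
set b := f a in afa ginc *; set d := g a in aga finc *.
have dn : (d < n)%N := gn a an; have bn : (b < n)%N := fn a an.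
have fd : f d = a := fgK a an; have gb : g b = a := gfK a an.
(* If the values jumped over [b + k + 1], monotonicity of [g] from [b] on would put its preimage
   strictly between two consecutive positions. *)
have first_run k : (a + k < d)%N -> f (a + k)%N = (b + k)%N.
  elim: k => [|k IH] kd; first by rewrite !addn0.
  have {}IH : f (a + k)%N = (b + k)%N by apply: IH; lia.
  have lt1 : (f (a + k)%N < f (a + k.+1)%N)%N by apply: finc; lia.
  have fn1 := fn (a + k.+1)%N ltac:(lia).
  have [lt2|] := ltnP (b + k).+1 (f (a + k.+1)%N); last by lia.
  have ltn : ((b + k).+1 < n)%N by lia.
  have g1 : (g (f (a + k)%N) < g (b + k).+1)%N by apply: ginc; lia.
  have g2 : (g (b + k).+1 < g (f (a + k.+1)%N))%N by apply: ginc; lia.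
  by move: g1 g2; rewrite !gfK; lia.
have cn : (b + (d - a) <= n)%N.
  have := first_run (d.-1 - a)%N ltac:(lia); have := fn d.-1 ltac:(lia).
  by rewrite (_ : (a + (d.-1 - a))%N = d.-1); lia.
split=> //.
have image_first x : (x < n)%N -> (b <= f x < b + (d - a))%N -> (x < d)%N.
  move=> xn bfx; have := first_run (f x - b)%N ltac:(lia).
  have -> : (b + (f x - b))%N = f x by lia.
  by move=> /(congr1 g); rewrite !gfK; lia.
(* From [d] on, the values climb from [a] and reach [b - 1] just before position [b + (d - a)],
   after which every point is fixed. *)
have second_run k : (d + k < n)%N ->
    f (d + k)%N = if (d + k < b + (d - a))%N then (a + k)%N else (d + k)%N.
  elim: k => [|k IH] kn; first by rewrite !addn0 fd; case: ifP; lia.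
  have {}IH := IH ltac:(lia).
  have lt1 : (f (d + k)%N < f (d + k.+1)%N)%N by apply: finc; lia.
  have fn1 := fn (d + k.+1)%N ltac:(lia).
  have Iout := image_first (d + k.+1)%N ltac:(lia).
  (* At [b - 1] the next values are occupied by the first run, so the least one left is
     [b + (d - a)]; skipping it would leave no place for its preimage. At any other value, that
     value and its successor lie on the same side of [b], where [g] increases. *)
  have [fk|fk] := eqVneq (f (d + k)%N) b.-1.
    have : ~~ (b + (d - a) < f (d + k.+1)%N)%N.
      apply/negP => lt2.
      have cn' : (b + (d - a) < n)%N by lia.
      have gcn := gn _ cn'; have fgc := fgK _ cn'.
      have g1 : (g (b + (d - a)) < g (f (d + k.+1)))%N by apply: ginc; lia.
      rewrite gfK in g1; last lia.
      have dg : (d <= g (b + (d - a)))%N.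
        rewrite leqNgt; apply/negP => gd.
        have [ga|ag] := ltnP (g (b + (d - a))) a.
          by have := fid _ ga; rewrite fgc; lia.
        by have := first_run (g (b + (d - a)) - a)%N ltac:(lia); rewrite subnKC // fgc; lia.
      have [e|ne] := eqVneq (g (b + (d - a))) (d + k)%N; first by rewrite e in fgc; lia.
      by have := finc (g (b + (d - a))) (d + k)%N ltac:(lia) ltac:(lia); rewrite fgc; lia.
    by move: IH; repeat case: ifP; lia.
  have : ~~ ((f (d + k)).+1 < f (d + k.+1)%N)%N.
    apply/negP => lt2.
    have Iout0 := image_first (d + k)%N ltac:(lia).
    have vn : ((f (d + k)%N).+1 < n)%N by lia.
    have g1 : (g (f (d + k)) < g (f (d + k)).+1)%N by apply: ginc; lia.
    rewrite gfK in g1; last lia.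
    have gvn := gn _ vn; have fgv := fgK _ vn.
    have [e|ne] := eqVneq (g (f (d + k)).+1) (d + k.+1)%N; first by rewrite e in fgv; lia.
    have [lt3|ge3] := ltnP (g (f (d + k)).+1) (d + k.+1)%N; first lia.
    by have := finc (d + k.+1)%N (g (f (d + k)).+1) ltac:(lia) ltac:(lia); rewrite fgv; lia.
  by move: IH; repeat case: ifP; lia.
move=> x xn; rewrite /block_fun.
have [xa|ax] := ltnP x a; first exact: fid.
have [xd|dx] := ltnP x d.
  have := first_run (x - a)%N ltac:(lia); rewrite subnKC // => ->.
  by repeat case: ifP; lia.
have := second_run (x - d)%N ltac:(lia); rewrite subnKC // => ->.
by repeat case: ifP; lia.
Qed.

Variable n : nat.
Implicit Types w : 'S_n.

(** Values below [a] stay at their own positions, so the entry just before the position of [a] is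
    larger than [a]. *)
Lemma descent_before_inv_first_moved w (a d d' : 'I_n) :
  (forall x : 'I_n, (x < a)%N -> w x = x) -> w d = a -> (a < d)%N ->
  d = d'.+1 :> nat -> d' \in descents w.
Proof.
move=> fid wd ad dd'; apply/descentP; exists d => //; rewrite wd.
rewrite ltnNge leq_eqVlt; apply/negP => /orP[/eqP/val_inj e|lt].
  by move: dd'; rewrite (perm_inj (etrans wd (esym e))); lia.
by have := fid _ lt => /perm_inj /(congr1 val) /=; lia.
Qed.

Lemma bigrassmannian_block w : w \in bigrassmannian n ->
  exists a b c, [/\ (a < b < c)%N, (c <= n)%N & is_block w a b c].
Proof.
rewrite inE => /andP[/cards1P[d' dw] /cards1P[e' ew]].
have [a0 wa0] : exists a, w a != a.
  apply/existsP; rewrite -negb_forall; apply/negP => /forallP wid.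
  have : d' \in descents w by rewrite dw finset.in_set1.
  by case/descentP => j jd; rewrite !(eqP (wid _)) jd; lia.
pose a := [arg min_(i < a0 | w i != i) i].
have [wa fid] : w a != a /\ forall x : 'I_n, (x < a)%N -> w x = x.
  rewrite /a; case: arg_minnP => // i wi imin; split=> // x xi.
  by apply/eqP/negP => /negP /imin; lia.
move: (a) wa fid => {}a wa fid.
have fidV (x : 'I_n) : (x < a)%N -> w^-1%g x = x.
  by move=> xa; rewrite -{1}(fid x xa) permK.
have gtP (v : 'S_n) (vid : forall x : 'I_n, (x < a)%N -> v x = x) : v a != a -> (a < v a)%N.
  move=> va; rewrite ltnNge leq_eqVlt; apply/negP => /orP[/eqP/val_inj|lt].
    by apply/eqP.
  by have /perm_inj := vid _ lt; apply/eqP.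
have wa1 : (a < w a)%N by apply: gtP.
have wa2 : (a < w^-1%g a)%N.
  by apply: gtP => //; apply: contra wa => /eqP e; rewrite -{1}e permKV.
(* This locates the two unique descents: that of [w] just before [w^-1 a], that of the inverse just
   before [w a]. *)
have dE : w^-1%g a = d'.+1 :> nat.
  have pn : ((w^-1%g a).-1 < n)%N by have := ltn_ord (w^-1%g a); lia.
  have := @descent_before_inv_first_moved w a (w^-1%g a) (Ordinal pn) fid (permKV _ _) wa2.
  by rewrite dw finset.in_set1 /= => /(_ ltac:(lia)) /eqP <- /=; lia.
have eE : w a = e'.+1 :> nat.
  have pn : ((w a).-1 < n)%N by have := ltn_ord (w a); lia.
  have := @descent_before_inv_first_moved w^-1%g a (w a) (Ordinal pn) fidV (permK _ _) wa1.
  by rewrite ew finset.in_set1 /= => /(_ ltac:(lia)) /eqP <- /=; lia.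
(* The value 0 outside the range is harmless, since only points below [n] are ever evaluated. *)
pose f x := if insub x is Some i then val (w i) else 0%N.
pose g x := if insub x is Some i then val (w^-1%g i) else 0%N.
have fE (x : 'I_n) : f x = w x by rewrite /f valK.
have gE (x : 'I_n) : g x = w^-1%g x by rewrite /g valK.
have onord (Q : nat -> Prop) : (forall x : 'I_n, Q x) -> forall x, (x < n)%N -> Q x.
  by move=> H x xn; exact: (H (Ordinal xn)).
have inc (v : 'S_n) (e : 'I_n) (c : nat) (h : nat -> nat) : descents v = [set e] -> c = e.+1 ->
    (forall x : 'I_n, h x = v x) -> forall x y, (x < y < n)%N ->
    (y < c)%N || (c <= x)%N -> (h x < h y)%N.
  move=> ve cE hE x y /andP[xy yn] H; have xn : (x < n)%N by lia.
  rewrite (hE (Ordinal xn)) (hE (Ordinal yn)).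
  by apply: (increasing_away_from_descent ve) => //=; lia.
have [cn fblock] : (f a + (g a - a) <= n)%N /\
    forall x, (x < n)%N -> f x = block_fun a (f a) (f a + (g a - a)) x.
  apply: monotone_pieces_block; rewrite ?fE ?gE //.
  - by apply: onord => x; rewrite fE.
  - by apply: onord => x; rewrite gE.
  - by apply: onord => x; rewrite gE fE permKV.
  - by apply: onord => x; rewrite fE gE permK.
  - by move=> x xa; have xn : (x < n)%N by [have := ltn_ord a; lia];
      rewrite (fE (Ordinal xn)) fid.
  - by apply: (inc w d') => //; rewrite gE.
  - by apply: (inc w^-1%g e') => //; rewrite fE.
exists a, (f a), (f a + (g a - a))%N; split=> //; first by rewrite fE gE; lia.
by move=> x; rewrite -fE; exact: fblock.
Qed.

End BigrassmannianBlocks.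

(** * The Bruhat order on block permutations *)

Section BruhatBlocks.
Variable n : nat.
Implicit Types w p s : 'S_n.

Lemma reductionP s p : reflect (exists i j : 'I_n,
   [/\ (i < j)%N, (s j < s i)%N & p = (tperm i j * s)%g]) (reduction s p).
Proof.
apply: (iffP existsP) => [[i /existsP[j /and3P[ij sij /eqP ->]]]|[i [j [ij sij ->]]]].
  by exists i, j.
by exists i; apply/existsP; exists j; rewrite ij sij eqxx.
Qed.

(** The order is a path of reductions starting at the larger permutation, so whatever one reduction
    preserves descends to the smaller one. *)
Lemma bruhat_down_ind (Q : 'S_n -> Prop) p s :
  (forall s p, reduction s p -> Q s -> Q p) -> bruhat p s -> Q s -> Q p.
Proof.
move=> QR /connectP[r]; elim: r s => [|s' r IH] s /= => [_ -> //|].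
by move=> /andP[ss' s'r] lst Qs; apply: IH s'r lst _; apply: QR ss' Qs.
Qed.

Lemma bruhat_trans p q s : bruhat p q -> bruhat q s -> bruhat p s.
Proof. by move=> pq qs; apply: connect_trans qs pq. Qed.

(** Exchanging the positions [i] and [j] of [q] exchanges, in the inverse, the positions [q j] and
    [q i]; this is again a reduction. *)
Lemma bruhat_inv p s : bruhat p s -> bruhat p^-1%g s^-1%g.
Proof.
move=> ps; apply: (bruhat_down_ind (Q := fun q => bruhat q^-1%g s^-1%g) _ ps).
  move=> {p ps} q p /reductionP[i [j [ij qij ->]]] qs.
  apply: bruhat_trans qs; apply: connect1; apply/reductionP.
  exists (q j), (q i); rewrite !permK; split=> //.
  by rewrite -tpermJ conjgE invMg tpermV [tperm j i]tpermC !mulgA mulgK.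
exact: connect0.
Qed.

(** A reduction moves the larger entry to the right, where the bound is weaker, and replaces it by a
    smaller one. *)
Lemma displacement_bruhat p s r :
  bruhat p s -> (forall k, s k <= k + r)%N -> (forall k, p k <= k + r)%N.
Proof.
apply: (bruhat_down_ind (Q := fun s : 'S_n => forall k, s k <= k + r)%N).
move=> {p s} s p /reductionP[i [j [ij sij ->]]] H k; rewrite permM.
by case: tpermP => [->|->|_ _] //; [have := H i|have := H i]; lia.
Qed.

(** A reduction cannot involve a position [i < a]: the smaller value [s j] would itself be a fixed
    point, so [j = s j < s i = i]. *)
Lemma fixed_below_bruhat p s a : bruhat p s ->
  (forall k : 'I_n, k < a -> s k = k)%N -> (forall k : 'I_n, k < a -> p k = k)%N.
Proof.
apply: (bruhat_down_ind (Q := fun s : 'S_n => forall k : 'I_n, k < a -> s k = k)%N).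
move=> {p s} s p /reductionP[i [j [ij sij ->]]] H.
have ai : (a <= i)%N.
  rewrite leqNgt; apply/negP => ia; have si := H _ ia; rewrite si in sij.
  by have /perm_inj jE := H (s j) ltac:(lia); rewrite jE in sij; lia.
move=> k ka; rewrite permM tpermD ?H //; apply/eqP => e; subst k; lia.
Qed.

Lemma fixed_above_bruhat p s c : bruhat p s ->
  (forall k : 'I_n, c <= k -> s k = k)%N -> (forall k : 'I_n, c <= k -> p k = k)%N.
Proof.
apply: (bruhat_down_ind (Q := fun s : 'S_n => forall k : 'I_n, c <= k -> s k = k)%N).
move=> {p s} s p /reductionP[i [j [ij sij ->]]] H.
have ai : (j < c)%N.
  rewrite ltnNge; apply/negP => ia; have si := H _ ia; rewrite si in sij.
  by have /perm_inj jE := H (s i) ltac:(lia); rewrite jE in sij; lia.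
move=> k ka; rewrite permM tpermD ?H //; apply/eqP => e; subst k; lia.
Qed.

(** Four quantities that cannot increase downwards give the four inequalities: the fixed points at
    either end bound [a'] and [c'], the displacements of the permutation and of its inverse bound
    the run lengths. *)
Lemma block_bruhat_le p w a b c a' b' c' :
  (a < b < c)%N -> (c <= n)%N -> (a' < b' < c')%N -> (c' <= n)%N ->
  is_block w a b c -> is_block p a' b' c' -> bruhat p w ->
  [/\ (a <= a')%N, (c' <= c)%N, (b' - a' <= b - a)%N & (c' - b' <= c - b)%N].
Proof.
move=> abc cn abc' cn' wE pE pw.
have a'n : (a' < n)%N by lia.
have pa' := pE (Ordinal a'n); rewrite /block_fun /= in pa'.
have c'n : (c'.-1 < n)%N by lia.
have pc' := pE (Ordinal c'n); rewrite /block_fun /= in pc'.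
have wD (k : 'I_n) : (w k <= k + (b - a))%N.
  by rewrite wE /block_fun; repeat case: ifP; lia.
have wVD (k : 'I_n) : (w^-1%g k <= k + (c - b))%N.
  rewrite (is_blockV abc cn wE) /block_fun; repeat case: ifP; lia.
have pVa' := is_blockV abc' cn' pE (Ordinal a'n); rewrite /block_fun /= in pVa'.
split.
- rewrite leqNgt; apply/negP => aa'.
  have wf (k : 'I_n) : (k < a)%N -> w k = k.
    by move=> ka; apply/val_inj; rewrite /= wE /block_fun ka.
  have := @fixed_below_bruhat _ _ _ pw wf (Ordinal a'n) aa' => /(congr1 val) /=.
  by rewrite pa'; repeat case: ifP; lia.
- rewrite leqNgt; apply/negP => cc'.
  have wf (k : 'I_n) : (c <= k)%N -> w k = k.
    by move=> ka; apply/val_inj; rewrite /= wE /block_fun; repeat case: ifP; lia.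
  have := @fixed_above_bruhat _ _ _ pw wf (Ordinal c'n) => /(_ ltac:(simpl; lia)) /(congr1 val) /=.
  by rewrite pc'; repeat case: ifP; lia.
- have := displacement_bruhat pw wD (Ordinal a'n); rewrite pa' /=.
  by repeat case: ifP; lia.
- have := displacement_bruhat (bruhat_inv pw) wVD (Ordinal a'n); rewrite pVa' /=.
  by repeat case: ifP; lia.
Qed.

(** The small entry at [j] is carried to [i] by adjacent exchanges. It passes only larger entries,
    so each exchange is a reduction, and the passed entries shift right by one. *)
Lemma bruhat_move_left s (i j : 'I_n) : (i <= j)%N ->
  (forall k : 'I_n, (i <= k < j)%N -> (s j < s k)%N) ->
  exists p, [/\ bruhat p s, p i = s j,
    forall k k' : 'I_n, (i <= k < j)%N -> k' = k.+1 :> nat -> p k' = s k &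
    forall k : 'I_n, (k < i)%N || (j < k)%N -> p k = s k].
Proof.
move=> /subnKC; move: (j - i)%N => m; elim: m => [|m IH] in s j * => ij sj.
  have -> : j = i by apply/val_inj; rewrite /= -ij addn0.
  by exists s; split=> // [|k k' ? ?]; [exact: connect0|lia].
have j1n : (i + m < n)%N by have := ltn_ord j; lia.
pose j1 := Ordinal j1n; pose s1 := (tperm j1 j * s)%g.
have j1j : (j1 < j)%N by rewrite /=; lia.
have s1E (k : 'I_n) : k != j1 -> k != j -> s1 k = s k.
  by move=> k1 k2; rewrite permM tpermD // eq_sym.
have s1j1 : s1 j1 = s j by rewrite permM tpermL.
have s1j : s1 j = s j1 by rewrite permM tpermR.
have s1s : bruhat s1 s.
  by apply: connect1; apply/reductionP; exists j1, j; split=> //; apply: sj => /=; lia.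
have [||p [ps1 pi pk pout]] := IH s1 j1; first by [].
  by move=> k /= kj; rewrite s1j1 s1E ?sj -?val_eqE /=; lia.
exists p; split=> [|| k k' kj k'k | k kout]; first exact: bruhat_trans ps1 s1s.
- by rewrite pi.
- have [kj1|kj1] := eqVneq k j1; last first.
    have : (k < j1)%N by move: kj1; rewrite -val_eqE /=; lia.
    by move=> ?; rewrite (pk k) ?s1E -?val_eqE //=; lia.
  have -> : k' = j by apply/val_inj; rewrite /= k'k kj1 /=; lia.
  by rewrite kj1 pout ?s1j //=; lia.
by rewrite pout ?s1E -?val_eqE //=; lia.
Qed.

Lemma bruhat_move_right s (i j : 'I_n) : (i <= j)%N ->
  (forall k : 'I_n, (i < k <= j)%N -> (s k < s i)%N) ->
  exists p, [/\ bruhat p s, p j = s i,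
    forall k k' : 'I_n, (i <= k < j)%N -> k' = k.+1 :> nat -> p k = s k' &
    forall k : 'I_n, (k < i)%N || (j < k)%N -> p k = s k].
Proof.
move=> /subnKC; move: (j - i)%N => m; elim: m => [|m IH] in s i * => ij sj.
  have -> : j = i by apply/val_inj; rewrite /= -ij addn0.
  by exists s; split=> // [|k k' ? ?]; [exact: connect0|lia].
have i1n : (i.+1 < n)%N by have := ltn_ord j; lia.
pose i1 := Ordinal i1n; pose s1 := (tperm i i1 * s)%g.
have s1E (k : 'I_n) : k != i -> k != i1 -> s1 k = s k.
  by move=> k1 k2; rewrite permM tpermD // eq_sym.
have s1i1 : s1 i1 = s i by rewrite permM tpermR.
have s1i : s1 i = s i1 by rewrite permM tpermL.
have s1s : bruhat s1 s.
  by apply: connect1; apply/reductionP; exists i, i1; split=> //; apply: sj => /=; lia.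
have [||p [ps1 pi pk pout]] := IH s1 i1; first by rewrite /=; lia.
  by move=> k /= kj; rewrite s1i1 s1E ?sj -?val_eqE /=; lia.
exists p; split=> [|| k k' kj k'k | k kout]; first exact: bruhat_trans ps1 s1s.
- by rewrite pi.
- have [kj1|kj1] := eqVneq k i; last first.
    have : (i < k)%N by move: kj1; rewrite -val_eqE /=; lia.
    by move=> ?; rewrite (pk k k') ?s1E -?val_eqE //=; lia.
  have -> : k' = i1 by apply/val_inj; rewrite /= k'k kj1.
  by rewrite kj1 pout ?s1i //=; lia.
by rewrite pout ?s1E -?val_eqE //=; lia.
Qed.

(** The value [a] heads the second run, at position [a + (c - b)]. Carrying it left to position [a]
    makes [a] a fixed point and shifts the first run. *)
Lemma block_shrink_left p w a b c : (a.+1 < b)%N -> (b < c <= n)%N ->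
  is_block w a b c -> is_block p a.+1 b c -> bruhat p w.
Proof.
move=> ab bc wE pE.
have an : (a < n)%N by lia.
have jn : (a + (c - b) < n)%N by lia.
have [||q [qw qi qk qout]] := @bruhat_move_left w (Ordinal an) (Ordinal jn).
- by rewrite /=; lia.
- by move=> k /= kj; rewrite !wE /block_fun /=; repeat case: ifP; lia.
suff -> : p = q by [].
apply: (is_block_inj pE) => x.
have [xa|xa] := ltnP x a.
  by rewrite qout ?xa // wE /block_fun; repeat case: ifP; lia.
have [->|xa'] := eqVneq x (Ordinal an).
  by rewrite qi wE /block_fun /=; repeat case: ifP; lia.
rewrite -val_eqE /= in xa'.
have [xj|xj] := leqP x (a + (c - b)).
  have x1n : (x.-1 < n)%N by have := ltn_ord x; lia.
  rewrite (qk (Ordinal x1n) x) /=; [|lia|lia].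
  by rewrite wE /block_fun /=; repeat case: ifP; lia.
by rewrite qout /= ?xj ?orbT // wE /block_fun; repeat case: ifP; lia.
Qed.

(** The value [c - 1] ends the first run; carrying it right to position [c - 1] makes it a fixed
    point. *)
Lemma block_shrink_right p w a b c : (a < b)%N -> (b.+1 < c)%N -> (c <= n)%N ->
  is_block w a b c -> is_block p a b c.-1 -> bruhat p w.
Proof.
move=> ab bc cn wE pE.
have an : ((a + (c - b)).-1 < n)%N by lia.
have jn : (c.-1 < n)%N by lia.
have [||q [qw qi qk qout]] := @bruhat_move_right w (Ordinal an) (Ordinal jn).
- by rewrite /=; lia.
- by move=> k /= kj; rewrite !wE /block_fun /=; repeat case: ifP; lia.
suff -> : p = q by [].
apply: (is_block_inj pE) => x.
have [xa|xa] := ltnP x (a + (c - b)).-1.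
  by rewrite qout ?xa // wE /block_fun; repeat case: ifP; lia.
have [->|xa'] := eqVneq x (Ordinal jn).
  by rewrite qi wE /block_fun /=; repeat case: ifP; lia.
rewrite -val_eqE /= in xa'.
have [xj|xj] := ltnP x c.-1.
  have x1n : (x.+1 < n)%N by lia.
  rewrite (qk x (Ordinal x1n)) /=; [|lia|lia].
  by rewrite wE /block_fun /=; repeat case: ifP; lia.
by rewrite qout /= ?wE /block_fun; repeat case: ifP; lia.
Qed.

(** Induction on the total amount by which the outer block exceeds the inner one at its two ends.
    Each step cuts one point off an end, choosing the run that is still too long. *)
Lemma block_bruhat p w a b c a' b' c' :
  (a < b < c)%N -> (c <= n)%N -> (a' < b' < c')%N ->
  is_block w a b c -> is_block p a' b' c' ->
  (a <= a')%N -> (c' <= c)%N -> (b' - a' <= b - a)%N -> (c' - b' <= c - b)%N ->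
  bruhat p w.
Proof.
move: {2}(a' - a + (c - c'))%N (leqnn (a' - a + (c - c'))%N) => m.
elim: m => [|m IH] in w a b c *.
  move=> ? abc cn abc' wE pE ? ? ? ?.
  have [? ? ?] : [/\ a = a', b = b' & c = c'] by split; lia.
  by subst; rewrite (is_block_inj pE wE); exact: connect0.
move=> ? abc cn abc' wE pE aa' cc' bb' qq'.
have shrink a1 b1 c1 : (a1 < b1 < c1)%N -> (c1 <= n)%N ->
  (forall w1, is_block w1 a1 b1 c1 -> bruhat w1 w) ->
  (a1 <= a')%N -> (c' <= c1)%N -> (b' - a' <= b1 - a1)%N -> (c' - b' <= c1 - b1)%N ->
  (a' - a1 + (c1 - c') <= m)%N -> bruhat p w.
  move=> abc1 cn1 H ? ? ? ? ?; have [w1 w1E] := block_exists abc1 cn1.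
  by apply: bruhat_trans (H _ w1E); apply: (IH w1 a1 b1 c1).
have wVE := is_blockV abc cn wE.
have [lta|gea] := ltnP a a'.
  have [ltp|gep] := ltnP (b' - a') (b - a).
    apply: (shrink a.+1 b c); try lia.
    by move=> w1 w1E; apply: block_shrink_left wE w1E; lia.
  (* The length [b - a] is already the required one, so [c - b] is still too large and is the one to
     cut. For the inverse this is the shrinking on the left proved before. *)
  apply: (shrink a.+1 b.+1 c); try lia.
  move=> w1 w1E; rewrite -[w1]invgK -[w]invgK; apply: bruhat_inv.
  apply: (block_shrink_left _ _ wVE); first lia; first lia.
  have := is_blockV _ cn w1E => /(_ ltac:(lia)).
  by rewrite (_ : a.+1 + (c - b.+1) = a + (c - b))%N //; lia.
have [ltc|gec] := ltnP c' c; last first.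
  have [? ? ?] : [/\ a = a', b = b' & c = c'] by split; lia.
  by subst; rewrite (is_block_inj pE wE); exact: connect0.
have [ltp|gep] := ltnP (c' - b') (c - b).
  apply: (shrink a b c.-1); try lia.
  by move=> w1 w1E; apply: block_shrink_right wE w1E; lia.
apply: (shrink a b.-1 c.-1); try lia.
move=> w1 w1E; rewrite -[w1]invgK -[w]invgK; apply: bruhat_inv.
apply: (block_shrink_right _ _ _ wVE); try lia.
have := is_blockV _ _ w1E => /(_ ltac:(lia) ltac:(lia)).
by rewrite (_ : a + (c.-1 - b.-1) = a + (c - b))%N //; lia.
Qed.

End BruhatBlocks.

(** * Counting *)

Section CountingTriples.

Lemma sum_interval N lo hi : \sum_(a < N) (lo <= a < hi)%N = (minn N hi - lo)%N.
Proof.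
elim: N => [|N IH]; first by rewrite big_ord0 min0n.
by rewrite big_ord_recr /= IH; case: (leqP lo N) => ?; case: (ltnP N hi) => ? /=; lia.
Qed.

(** Coordinates are changed from the triple to its two gaps and its first point; for gaps [p] and
    [q] the first point has [hi - lo - p - q] choices. The window from [lo] to [hi] serves both for
    all triples and for those below a given one. *)
Lemma card_triples N lo hi (E : nat -> nat -> bool) : (hi <= N)%N ->
  #|[set t : 'I_N * 'I_N * 'I_N |
       [&& lo <= t.1.1, t.1.1 < t.1.2, t.1.2 < t.2, t.2 < hi &
           E (t.1.2 - t.1.1) (t.2 - t.1.2)]%N]| =
  (\sum_(p < N) \sum_(q < N) ([&& 0 < p, 0 < q & E p q] * (hi - lo - p - q)))%N.
Proof.
move=> hiN.
pose gap (x y : 'I_N) : 'I_N := Ordinal (leq_ltn_trans (leq_subr x y) (ltn_ord y)).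
pose phi (t : 'I_N * 'I_N * 'I_N) := (gap t.1.1 t.1.2, gap t.1.2 t.2, t.1.1).
rewrite -(card_in_imset (f := phi)); last first.
  move=> [[a b] c] [[a' b'] c']; rewrite !finset.inE /= => H H' [h1 h2 h3].
  by congr (_, _, _); apply/val_inj => /=; rewrite h3 in h1 *; lia.
rewrite pair_big /= -sum1_card big_mkcond /=.
transitivity (\sum_(i : 'I_N * 'I_N) \sum_(a < N)
    [&& 0 < i.1, 0 < i.2 & E i.1 i.2] * (lo <= a < hi - i.1 - i.2))%N; last first.
  apply: eq_bigr => -[p q] _ /=; rewrite -big_distrr /= sum_interval.
  by congr (_ * _)%N; lia.
rewrite pair_bigA /=; apply: eq_bigr => -[[p q] a] _ /=.
rewrite -/(nat_of_bool _).
have -> : ((p, q, a) \in [set phi t | t in [set t : 'I_N * 'I_N * 'I_N |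
       [&& lo <= t.1.1, t.1.1 < t.1.2, t.1.2 < t.2, t.2 < hi &
           E (t.1.2 - t.1.1) (t.2 - t.1.2)]%N]])%SET =
   [&& 0 < p, 0 < q & E p q]%N && (lo <= a < hi - p - q)%N; last by rewrite -mulnb; case: (_ && _).
apply/imsetP/idP => [[[[a' b] c]] /[!finset.inE] /= H [-> -> ->]/=|H].
  by case/and5P: H => ? ? ? ? ->; lia.
have bn : (a + p < N)%N by lia.
have cn : (a + p + q < N)%N by lia.
exists (a, Ordinal bn, Ordinal cn).
  by rewrite finset.inE /=; move: H => /andP[/and3P[? ? Epq]] ?;
    rewrite addKn addKn Epq; lia.
by rewrite /phi /gap; congr (_, _, _); apply/val_inj => /=; lia.
Qed.

End CountingTriples.

(** * The sum over a box of gaps *)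

Section BoxSums.

Lemma sum_prefix N m (F : nat -> nat) : (m < N)%N ->
  (\sum_(i < N) (0 < i <= m) * F i = \sum_(i < m) F i.+1)%N.
Proof.
case: N => // N mN; rewrite big_ord_recl mul0n add0n.
rewrite (big_ord_widen _ (fun i => F i.+1) (mN : m <= N)%N) [RHS]big_mkcond.
by apply: eq_bigr => i _; rewrite mulnbl /bump.
Qed.

(** The weight counts the placements of a block with gaps [i] and [j] in a window of [p + q + 1]
    points. Under reflection of the box its average is [(p + q) / 2]. *)
Lemma sum_box p q N : (p + q < N)%N ->
  (2 * \sum_(i < N) \sum_(j < N)
     ([&& 0 < i, 0 < j & (i <= p) && (j <= q)] * ((p + q).+1 - i - j)) = p * q * (p + q))%N.
Proof.
move=> pqN.
transitivity (2 * \sum_(i < N) ((0 < i <= p) *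
    \sum_(j < N) (0 < j <= q) * ((p + q).+1 - i - j)))%N.
  congr (_ * _)%N; apply: eq_bigr => i _; rewrite big_distrr; apply: eq_bigr => j _ /=.
  by case: (0 < i)%N => //=; case: (i <= p)%N; rewrite /= ?mul1n ?mul0n ?andbF ?andbT ?mul0n.
rewrite (@sum_prefix N p (fun i => \sum_(j < N) (0 < j <= q) * ((p + q).+1 - i - j))%N); last lia.
under eq_bigr => i _.
  rewrite (@sum_prefix N q (fun j => (p + q).+1 - i.+1 - j))%N; last lia.
  (* Reversing both indices turns the weight into [i + 1 + j], free of truncated subtraction. *)
  rewrite (reindex_inj rev_ord_inj) /=.
  rewrite (eq_bigr (fun j : 'I_q => (p - i.+1).+1 + j)%N); last first.
    by move=> j _; have := ltn_ord i; have := ltn_ord j; lia.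
  over.
rewrite (reindex_inj rev_ord_inj) /=.
under eq_bigr => i _.
  rewrite (eq_bigr (fun j : 'I_q => i.+1 + j)%N); last first.
    by move=> j _; have := ltn_ord i; have := ltn_ord j; lia.
  rewrite big_split /= sum_nat_const card_ord.
  over.
rewrite /= big_split /= sum_nat_const card_ord -big_distrr /=.
have G m : (2 * \sum_(i < m) i = m * m.-1)%N.
  by elim: m => [|m IH]; [rewrite big_ord0 | rewrite big_ord_recr /= mulnDr IH; nia].
have G' m : (2 * \sum_(i < m) i.+1 = m * m.+1)%N.
  by elim: m => [|m IH]; [rewrite big_ord0 | rewrite big_ord_recr /= mulnDr IH; nia].
rewrite mulnDr (mulnCA 2 q) (mulnCA 2 p) G G'.
by case: (q) => [|r] /=; [rewrite !muln0 | ring].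
Qed.

End BoxSums.

(** * Counting bigrassmannian permutations by their triples *)

Section CountingBlocks.
Variable n : nat.
Implicit Types w p s : 'S_n.

Lemma bigrassmannian_triple w : w \in bigrassmannian n ->
  is_block_triple w (block_triple w).
Proof.
move=> /bigrassmannian_block[a [b [c [abc cn wE]]]].
have an : (a < n.+1)%N by lia.
have bn : (b < n.+1)%N by lia.
rewrite /block_triple; case: pickP => //= /(_ (Ordinal an, Ordinal bn, Ordinal (cn : c < n.+1)%N)).
by move/negP; case; apply/is_block_tripleP; split=> //=; lia.
Qed.

Lemma ell_triple w (t := block_triple w) :
  ell2 w = (t.1.2 - t.1.1)%N /\ ell3 w = (t.2 - t.1.2)%N.
Proof. by rewrite /ell2 /ell3 /t; case: block_triple => -[]. Qed.

(** [block_triple] is a bijection from the bigrassmannian permutations onto the triples [a < b < c],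
    so every count becomes a count of triples. *)
Lemma card_bigrassmannian_triples (D : pred ('I_n.+1 * 'I_n.+1 * 'I_n.+1)) :
  #|[set w in bigrassmannian n | D (block_triple w)]| =
  #|[set t : 'I_n.+1 * 'I_n.+1 * 'I_n.+1 | [&& t.1.1 < t.1.2, t.1.2 < t.2 & D t]%N]|.
Proof.
rewrite -(card_in_imset (f := @block_triple n)); last first.
  move=> w1 w2 /setIdP[+ _] /setIdP[+ _] e.
  move=> /bigrassmannian_triple/is_block_tripleP[_ _ w1E].
  move=> /bigrassmannian_triple/is_block_tripleP[_ _ w2E].
  by apply: is_block_inj w1E _; rewrite e.
congr #|pred_of_set _|; apply/setP => t; rewrite finset.in_set.
apply/imsetP/and3P => [[w]|[ab bc Dt]].
  move=> /setIdP[/bigrassmannian_triple/is_block_tripleP[ab bc _] Dw] ->.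
  by split.
have cn : (t.2 <= n)%N by rewrite -ltnS.
have abc : (t.1.1 < t.1.2 < t.2)%N by rewrite ab.
have [w wE] := block_exists abc cn.
have wB := block_bigrassmannian abc cn wE.
have e : t = block_triple w.
  have /is_block_tripleP[ab' bc' wE'] := bigrassmannian_triple wB.
  have cn' : ((block_triple w).2 <= n)%N by rewrite -ltnS.
  have abc' : ((block_triple w).1.1 < (block_triple w).1.2 < (block_triple w).2)%N.
    by rewrite ab'.
  have [] := is_block_unique abc cn abc' cn' wE wE'.
  case: (t) (block_triple w) => -[a b] c [[a' b'] c'] /=.
  by move=> /val_inj -> /val_inj -> /val_inj ->.
by exists w => //; apply/setIdP; rewrite -e.
Qed.

Lemma card_bigrassmannian_ell (E : nat -> nat -> bool) :
  #|[set w in bigrassmannian n | E (ell2 w) (ell3 w)]| =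
  (\sum_(p < n.+1) \sum_(q < n.+1) ([&& 0 < p, 0 < q & E p q] * (n.+1 - p - q)))%N.
Proof.
have := @card_triples n.+1 0 n.+1 E (leqnn _).
under [in X in _ = X -> _]eq_bigr do under eq_bigr do rewrite subn0.
move=> <-.
pose D (t : 'I_n.+1 * 'I_n.+1 * 'I_n.+1) := E (t.1.2 - t.1.1)%N (t.2 - t.1.2)%N.
transitivity #|[set w in bigrassmannian n | D (block_triple w)]|.
  congr #|pred_of_set _|; apply/setP => w; rewrite [LHS]finset.in_set [RHS]finset.in_set /D.
  by have [-> ->] := ell_triple w.
rewrite card_bigrassmannian_triples; congr #|pred_of_set _|.
by apply/setP => t; rewrite !finset.inE /= ltn_ord.
Qed.

Lemma beta_bigrassmannian w : w \in bigrassmannian n ->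
  (2 * beta w = ell2 w * ell3 w * (ell2 w + ell3 w))%N.
Proof.
move=> wB; have [-> ->] := ell_triple w.
have /is_block_tripleP[] := bigrassmannian_triple wB.
move: (block_triple w) => -[[a b] c] /= ab bc wE.
have cn : (c <= n)%N by rewrite -ltnS.
have abc : (a < b < c)%N by rewrite ab.
pose D (t : 'I_n.+1 * 'I_n.+1 * 'I_n.+1) :=
  [&& a <= t.1.1, t.2 <= c, t.1.2 - t.1.1 <= b - a & t.2 - t.1.2 <= c - b]%N.
(* The Bruhat order on block permutations is exactly the four inequalities in [D]. *)
have -> : beta w = #|[set p in bigrassmannian n | D (block_triple p)]|.
  congr #|pred_of_set _|; apply/setP => p.
  rewrite [LHS]finset.in_set [RHS]finset.in_set; apply: andb_id2l.
  move=> pB; rewrite /D.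
  have /is_block_tripleP[] := bigrassmannian_triple pB.
  move: (block_triple p) => -[[a' b'] c'] /= ab' bc' pE.
  have cn' : (c' <= n)%N by rewrite -ltnS.
  have abc' : (a' < b' < c')%N by rewrite ab'.
  apply/idP/and4P => [/(block_bruhat_le abc cn abc' cn' wE pE)//|[]].
  exact: block_bruhat abc cn abc' wE pE.
rewrite card_bigrassmannian_triples -(@sum_box (b - a) (c - b) n.+1); last lia.
have -> : ((b - a + (c - b)).+1 = c.+1 - a)%N by lia.
rewrite -(@card_triples n.+1 a c.+1 (fun i j => (i <= b - a) && (j <= c - b))%N) //.
congr (2 * #|pred_of_set _|)%N; apply/setP => t; rewrite !finset.inE /D ltnS; lia.
Qed.

End CountingBlocks.

Local Open Scope ring_scope.

(** * Tail counts of the two lengths and their limit *)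

Section SurvivalCounts.

(** The hockey-stick identity, started at [t]. The condition on [M] makes the binomials with
    [j >= N] vanish, so the sum over [j < N] is complete. *)
Lemma sum_binomial_tail N M t k : (M <= N + k)%N ->
  (\sum_(j < N) (t <= j) * 'C(M - j, k.+1) = 'C((M - t).+1, k.+2))%N.
Proof.
elim: N => [|N IH] in M t *.
  by rewrite big_ord0 add0n => Mk; rewrite bin_small //; lia.
case: M => [|M] MN.
  by rewrite bin_small // big1 // => j _; rewrite bin_small ?muln0.
rewrite big_ord_recl subn0 /=.
case: t => [|t].
  have := IH M 0%N ltac:(lia); rewrite leq0n mul1n !subn0 => IH0; rewrite [RHS]binS addnC -IH0.
  by congr (_ + _)%N; apply: eq_bigr => j _; rewrite /bump subSS.
have := IH M t ltac:(lia); rewrite mul0n subSS => <-.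
by apply: eq_bigr => j _; rewrite /bump subSS.
Qed.

(** The hockey-stick identity is applied twice, over the second gap and then over the first. *)
Lemma card_bigrassmannian_ge n s t : (0 < s)%N -> (0 < t)%N ->
  #|[set w in bigrassmannian n | (s <= ell2 w)%N && (t <= ell3 w)%N]| =
  'C((n.+2 - t - s).+1, 3).
Proof.
move=> s0 t0.
rewrite (@card_bigrassmannian_ell n (fun p q => (s <= p) && (t <= q))%N).
rewrite -(@sum_binomial_tail n.+1 (n.+2 - t) s 1); last lia.
apply: eq_bigr => p _.
transitivity ((s <= p) * \sum_(q < n.+1) (t <= q) * 'C(n.+1 - p - q, 1))%N.
  by rewrite big_distrr /=; apply: eq_bigr => q _; rewrite bin1 mulnA mulnb;
    congr (nat_of_bool _ * _)%N; lia.
rewrite sum_binomial_tail; last lia.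
(* When [p + t > n + 1] the truncated subtractions no longer agree, but both binomials are 0. *)
congr (_ * _)%N; case: (leqP (p + t) n.+1) => pt; last by rewrite !bin_small //; lia.
by congr 'C(_, _); lia.
Qed.

Lemma card_bigrassmannian n : #|bigrassmannian n| = 'C(n.+1, 3).
Proof.
have -> : bigrassmannian n = [set w in bigrassmannian n | (1 <= ell2 w)%N && (1 <= ell3 w)%N].
  apply/setP => w; rewrite [RHS]finset.in_set; case: (boolP (w \in bigrassmannian n)) => //= wB.
  have /is_block_tripleP[] := bigrassmannian_triple wB.
  by have [-> ->] := ell_triple w; lia.
by rewrite card_bigrassmannian_ge // !subSS !subn0.
Qed.

(** Inclusion and exclusion over the four corners, with the negative terms moved to the other side
    to stay in [nat]. *)
Lemma card_bigrassmannian_rect n s0 s1 t0 t1 : (0 < s0 <= s1)%N -> (0 < t0 <= t1)%N ->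
  (#|[set w in bigrassmannian n | (s0 <= ell2 w < s1) && (t0 <= ell3 w < t1)]| +
    ('C((n.+2 - t0 - s1).+1, 3) + 'C((n.+2 - t1 - s0).+1, 3)) =
    'C((n.+2 - t0 - s0).+1, 3) + 'C((n.+2 - t1 - s1).+1, 3))%N.
Proof.
move=> s01 t01; rewrite -!card_bigrassmannian_ge; try lia.
have cE (D : pred 'S_n) :
    #|[set w in bigrassmannian n | D w]| = (\sum_(w in bigrassmannian n) D w)%N.
  by rewrite -sum1dep_card big_mkcondr; apply: eq_bigr => w _; case: (D w).
by rewrite !cE -!big_split; apply: eq_bigr => w _ /=; lia.
Qed.

Variable R : realType.

Lemma bin3E (m : nat) : 6 * 'C(m.+1, 3)%:R = m%:R ^+ 3 - m%:R :> R.
Proof.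
case: m => [|m]; first by rewrite bin_small //; ring.
have -> : 6 * 'C(m.+2, 3)%:R = ('C(m.+2, 3) * 3`!)%:R :> R by rewrite natrM mulrC.
by rewrite bin_ffact !ffactnS ffactn0 /= !natrM -[m.+2]addn2 -[m.+1]addn1 !natrD; ring.
Qed.

(** For nonnegative [x] and [y], the joint tail of two spacings of three uniform points. *)
Definition survival (x y : R) : R := Num.max 0 (1 - x - y) ^+ 3.

(** The quotient is [(m^3 - m) / (n^3 - n)] with [m] close to [n * z]. The tolerance 3 on [s] and
    [t] leaves room for rounding and for the coupling error. *)
Lemma survival_bin n s t (x y : R) : (1 < n)%N -> (0 < s)%N -> (0 < t)%N ->
  0 <= x -> 0 <= y -> `|s%:R - n%:R * x| <= 3 -> `|t%:R - n%:R * y| <= 3 ->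
  `|'C((n.+2 - t - s).+1, 3)%:R / 'C(n.+1, 3)%:R - survival x y| <= 50 / n%:R.
Proof.
move=> n1 s0 t0 x0 y0 sx ty.
set m := (n.+2 - t - s)%N.
have mn : (m <= n)%N by rewrite /m; lia.
set z := Num.max 0 (1 - x - y).
have z0 : 0 <= z by rewrite /z le_max lexx.
have z1 : z <= 1 by rewrite /z ge_max ler01 /=; lra.
have N2 : 2 <= n%:R :> R by rewrite (ler_nat R 2).
have mN : m%:R <= n%:R :> R by rewrite ler_nat.
have m0 : 0 <= m%:R :> R by [].
(* The bound 8 is 3 for [s], 3 for [t] and 2 for the shift in [n + 2]. *)
have mz : `|m%:R - n%:R * z| <= 8.
  have : (m%:R = Num.max 0 (n%:R + 2 - t%:R - s%:R) :> R).
    have [st|st] := leqP (t + s) n.+2.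
      have : (m + (t + s) = n + 2)%N by rewrite /m; lia.
      move=> /(congr1 (fun k => k%:R : R)); rewrite !natrD => e.
      by rewrite max_r; lra.
    have -> : m = 0%N by rewrite /m; lia.
    have : (n%:R + 2 < t%:R + s%:R :> R) by rewrite -!natrD ltr_nat; lia.
    by move=> ?; rewrite max_l //; lra.
  have nz : n%:R * z = Num.max 0 (n%:R * (1 - x - y)).
    by rewrite maxr_pMr ?mulr0 //; lra.
  move=> ->; rewrite nz; move: sx ty; rewrite !ler_norml !maxEle => sx ty.
  have e : n%:R * (1 - x - y) = n%:R - n%:R * x - n%:R * y by ring.
  by rewrite e; do 2 case: ifP => ?; lra.
have n3 : n%:R ^+ 3 - n%:R >= n%:R ^+ 3 / 2 :> R.
  have : n%:R ^+ 2 >= 2 * n%:R :> R by rewrite expr2 ler_wpM2r //; lra.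
  by rewrite exprS => ?; nra.
have n30 : 0 < n%:R ^+ 3 - n%:R :> R.
  by apply: lt_le_trans n3; rewrite divr_gt0 // exprn_gt0 //; lra.
have -> : 'C(m.+1, 3)%:R / 'C(n.+1, 3)%:R = (m%:R ^+ 3 - m%:R) / (n%:R ^+ 3 - n%:R) :> R.
  by rewrite -!bin3E invfM mulrACA divff ?mul1r.
have -> : (m%:R ^+ 3 - m%:R) / (n%:R ^+ 3 - n%:R) - survival x y =
  (m%:R ^+ 3 - (n%:R * z) ^+ 3 + (n%:R * z ^+ 3 - m%:R)) / (n%:R ^+ 3 - n%:R).
  by rewrite /survival -/z; field; rewrite gt_eqF.
rewrite normrM normfV (gtr0_norm n30) ler_pdivrMr //.
(* The difference of cubes costs [8 * 3 * n^2] and the linear terms at most [n^2]; with a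
   denominator of at least [n^3 / 2] this gives [50 / n]. *)
apply: (@le_trans _ _ (25 * n%:R ^+ 2)); last first.
  apply: le_trans (ler_wpM2l _ n3); last by rewrite divr_ge0.
  by rewrite le_eqVlt; apply/orP; left; apply/eqP; field; lra.
have nz0 : 0 <= n%:R * z by rewrite mulr_ge0.
have nzn : n%:R * z <= n%:R by rewrite ler_piMr.
have b1 : `|m%:R ^+ 3 - (n%:R * z) ^+ 3| <= 24 * n%:R ^+ 2.
  have -> : m%:R ^+ 3 - (n%:R * z) ^+ 3 =
     (m%:R - n%:R * z) * (m%:R ^+ 2 + m%:R * (n%:R * z) + (n%:R * z) ^+ 2) by ring.
  rewrite normrM (_ : 24 * n%:R ^+ 2 = 8 * (3 * n%:R ^+ 2)); last by ring.
  by apply: ler_pM => //; rewrite ger0_norm; nra.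
have b2 : `|n%:R * z ^+ 3 - m%:R| <= n%:R ^+ 2.
  have z3 : z ^+ 3 <= 1 by rewrite exprn_ile1.
  have z30 : 0 <= z ^+ 3 by rewrite exprn_ge0.
  by rewrite ler_norml; nra.
by apply: le_trans (ler_normD _ _) _; lra.
Qed.

Definition rect_mass (i0 i1 j0 j1 : R) : R :=
  survival i0 j0 - survival i1 j0 - survival i0 j1 + survival i1 j1.

(** Each of the four corners contributes an error of [50 / n]. *)
Lemma unif_pr_rect n (s0 s1 t0 t1 : nat) (i0 i1 j0 j1 : R) : (1 < n)%N ->
  (0 < s0 <= s1)%N -> (0 < t0 <= t1)%N ->
  0 <= i0 -> 0 <= i1 -> 0 <= j0 -> 0 <= j1 ->
  `|s0%:R - n%:R * i0| <= 3 -> `|s1%:R - n%:R * i1| <= 3 ->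
  `|t0%:R - n%:R * j0| <= 3 -> `|t1%:R - n%:R * j1| <= 3 ->
  `|unif_pr R (bigrassmannian n)
     (fun w => (s0 <= ell2 w < s1)%N && (t0 <= ell3 w < t1)%N) - rect_mass i0 i1 j0 j1|
  <= 200 / n%:R.
Proof.
move=> n1 s01 t01.
have [s00 s10 t00 t10] : [/\ (0 < s0)%N, (0 < s1)%N, (0 < t0)%N & (0 < t1)%N].
  by split; lia.
move=> i00 i10 j00 j10 hs0 hs1 ht0 ht1.
have natE (x y z u v : nat) : (x + (y + z) = u + v)%N ->
    x%:R + (y%:R + z%:R) = u%:R + v%:R :> R.
  by move=> /(congr1 (fun k => k%:R : R)); rewrite !natrD.
rewrite /unif_pr card_bigrassmannian.
have /natE := card_bigrassmannian_rect n s01 t01.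
have := survival_bin n1 s00 t00 i00 j00 hs0 ht0.
have := survival_bin n1 s10 t00 i10 j00 hs1 ht0.
have := survival_bin n1 s00 t10 i00 j10 hs0 ht1.
have := survival_bin n1 s10 t10 i10 j10 hs1 ht1.
rewrite /rect_mass !ler_norml.
set b : R := 'C(n.+1, 3)%:R; set c : R := #|_|%:R.
set c1 : R := 'C((n.+2 - t1 - s1).+1, 3)%:R; set c2 : R := 'C((n.+2 - t1 - s0).+1, 3)%:R.
set c3 : R := 'C((n.+2 - t0 - s1).+1, 3)%:R; set c4 : R := 'C((n.+2 - t0 - s0).+1, 3)%:R.
move=> ? ? ? ? /(congr1 (fun x => x / b)).
rewrite !mulrDl; lra.
Qed.

End SurvivalCounts.

(** * Coupling with three uniform points *)

Local Open Scope classical_set_scope.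
Local Open Scope ring_scope.

Section SpacingsFacts.
Variable R : realType.

(** A monotone map commutes with sorting, so the cells of the order statistics are the sorted cells
    of the points. *)
Lemma sort_truncn (N : R) (s : seq R) : 0 <= N ->
  [seq Num.truncn (N * x) | x <- sort <=%R s] = sort leq [seq Num.truncn (N * x) | x <- s].
Proof.
move=> N0; apply: (sorted_eq leq_trans anti_leq).
- apply: homo_sorted (sort_sorted le_total s) => x y xy.
  by rewrite le_truncn // ler_wpM2l.
- by rewrite sort_sorted //; exact: leq_total.
by apply: perm_trans (perm_map _ _) _; [rewrite perm_sort | rewrite perm_sym perm_sort].
Qed.

Definition cell (N : nat) (k : nat) : set R := `[k%:R / N%:R, k.+1%:R / N%:R[%classic.

Lemma cell_truncn N k x : (0 < N)%N -> cell N k x -> Num.truncn (N%:R * x) = k.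
Proof.
move=> N0; rewrite /cell /= in_itv /= => /andP[kx xk]; apply: truncn_def.
have NR : 0 < N%:R :> R by rewrite ltr0n.
by rewrite mulrC -ler_pdivrMr // kx /= -ltr_pdivlMr.
Qed.

Definition triple_nth (t : nat * nat * nat) (i : nat) : nat :=
  nth 0%N [:: t.1.1; t.1.2; t.2] i.

Lemma sort_cells N a b c (s : 'S_3) (u : 'I_3 -> R) : (0 < N)%N -> (a < b < c)%N ->
  (forall i, cell N (triple_nth (a, b, c) (s i)) (u i)) ->
  exists x y z, [/\ sort <=%R [seq u i | i <- enum 'I_3] = [:: x; y; z],
     cell N a x, cell N b y & cell N c z].
Proof.
move=> N0 abc us.
have NR : 0 < N%:R :> R by rewrite ltr0n.
have := @sort_truncn N%:R [seq u i | i <- enum 'I_3] (ltW NR).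
have -> : [seq Num.truncn (N%:R * x) | x <- [seq u i | i <- enum 'I_3]] =
    [seq triple_nth (a, b, c) (s i) | i <- enum 'I_3].
  by rewrite -map_comp; apply: eq_map => i /=; apply: cell_truncn.
have -> : sort leq [seq triple_nth (a, b, c) (s i) | i <- enum 'I_3] = [:: a; b; c].
  apply: (sorted_eq leq_trans anti_leq); first by rewrite sort_sorted //; exact: leq_total.
    by move=> /=; lia.
  rewrite perm_sort.
  have -> : [:: a; b; c] = [seq triple_nth (a, b, c) i | i <- map val (enum 'I_3)].
    by rewrite val_enum_ord.
  rewrite -map_comp (map_comp (fun i : 'I_3 => triple_nth (a, b, c) i) s); apply: perm_map.
  apply: uniq_perm; rewrite ?enum_uniq ?(map_inj_uniq perm_inj) ?enum_uniq //.
  move=> i; rewrite mem_enum; apply/mapP; exists (s^-1%g i); rewrite ?mem_enum //.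
  by rewrite permKV.
set S := sort _ _; have S_u x : x \in S -> 0 <= x.
  rewrite mem_sort => /mapP[i _ ->]; have := us i; rewrite /cell /= in_itv /= => /andP[+ _].
  by apply: le_trans; rewrite divr_ge0.
case: S S_u => [//|x [//|y [//|z [|//]]]] S_u [xa yb zc].
exists x, y, z; split=> //.
- rewrite -xa /cell /= in_itv /= ler_pdivrMr // ltr_pdivlMr // mulrC.
  by apply: truncn_itv; rewrite mulr_ge0 ?ler0n // S_u // !inE eqxx.
- rewrite -yb /cell /= in_itv /= ler_pdivrMr // ltr_pdivlMr // mulrC.
  by apply: truncn_itv; rewrite mulr_ge0 ?ler0n // S_u // !inE eqxx ?orbT.
- rewrite -zc /cell /= in_itv /= ler_pdivrMr // ltr_pdivlMr // mulrC.
  by apply: truncn_itv; rewrite mulr_ge0 ?ler0n // S_u // !inE eqxx ?orbT.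
Qed.

Definition near_spacings (n : nat) (p q : nat) (x y : R) : Prop :=
  [/\ 0 <= x <= 1, 0 <= y <= 1, `|p%:R / n%:R - x| <= 2 / n%:R & `|q%:R / n%:R - y| <= 2 / n%:R].

(** There are [n + 1] cells because [a], [b], [c] range over 0 to [n]. A spacing differs from
    [p / (n + 1)] by less than one cell width, and [p / (n + 1)] from [p / n] by at most another. *)
Lemma spacings_cells T (U : 'I_3 -> T -> R) n a b c (s : 'S_3) t :
  (0 < n)%N -> (a < b < c)%N -> (c <= n)%N ->
  (forall i, cell n.+1 (triple_nth (a, b, c) (s i)) (U i t)) ->
  near_spacings n (b - a) (c - b) (L2 U t) (L3 U t).
Proof.
move=> n0 abc cn /(sort_cells (ltn0Sn n) abc)[x [y [z [+ ax byy cz]]]].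
rewrite /near_spacings /L2 /L3 /order_stat => -> /=.
have nR : 1 <= n%:R :> R by rewrite ler1n.
have [ab bc] : (a + (b - a) = b /\ b + (c - b) = c)%N by lia.
have {}ab : a%:R + (b - a)%:R = b%:R :> R by rewrite -natrD ab.
have {}bc : b%:R + (c - b)%:R = c%:R :> R by rewrite -natrD bc.
have [p1 q1] : (1 <= b - a /\ 1 <= c - b)%N by lia.
have {}p1 : 1 <= (b - a)%:R :> R by rewrite ler1n.
have {}q1 : 1 <= (c - b)%:R :> R by rewrite ler1n.
have {}cn : c%:R <= n%:R :> R by rewrite ler_nat.
have a0 : 0 <= a%:R :> R by [].
move: ax byy cz; rewrite /cell /= !in_itv /= -(natr1 a) -(natr1 b) -(natr1 c) -(natr1 n).
move: (a%:R) (b%:R) (c%:R) ((b - a)%:R) ((c - b)%:R) (n%:R : R) nR ab bc p1 q1 cn a0.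
clear => a b c p q n n1 ab bc p1 q1 cn a0.
have n0 : 0 < n + 1 by lra.
have n0' : 0 < n by lra.
rewrite !ler_pdivrMr // !ltr_pdivlMr // => /andP[xa xa'] /andP[yb yb'] /andP[zc zc'].
have xy : x <= y by rewrite -(ler_pM2r n0); lra.
have yz : y <= z by rewrite -(ler_pM2r n0); lra.
have x0 : 0 <= x by rewrite -(ler_pM2r n0); lra.
have z1 : z <= 1 by rewrite -(ler_pM2r n0); lra.
have E r v : r / n - v = (r - n * v) / n by field; rewrite gt_eqF.
split; first lra; first lra.
- by rewrite E normrM normfV (gtr0_norm n0') ler_pM2r ?invr_gt0 // ler_norml; lra.
- by rewrite E normrM normfV (gtr0_norm n0') ler_pM2r ?invr_gt0 // ler_norml; lra.
Qed.

Lemma uniform_prob_cell N k : (k < N)%N ->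
  uniform_prob (@ltr01 R) (cell N k) = (N%:R^-1)%:E.
Proof.
move=> kN; have NR : 0 < N%:R :> R by rewrite ltr0n; lia.
rewrite /uniform_prob integral_uniform_pdf setIidl; last first.
  move=> x; rewrite /cell /= !in_itv /= => /andP[h1 h2]; apply/andP; split.
    by apply: le_trans h1; rewrite divr_ge0.
  by apply/ltW/(lt_le_trans h2); rewrite ler_pdivrMr // mul1r ler_nat.
rewrite (eq_integral (cst 1%E)); last first.
  move=> x; rewrite inE /cell /= in_itv /= => /andP[h1 h2].
  rewrite /uniform_pdf subr0 invr1 ifT //; apply/andP; split.
    by apply: le_trans h1; rewrite divr_ge0.
  by apply/ltW/(lt_le_trans h2); rewrite ler_pdivrMr // mul1r ler_nat.
rewrite integral_cst /cell; last exact: measurable_itv.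
rewrite mul1e [LHS]/= lebesgue_measure_itv /= lte_fin ltr_pM2r ?invr_gt0 // ltr_nat ltnSn.
by rewrite -EFinD -mulrBl -natrB // subSnn mul1r.
Qed.

End SpacingsFacts.

Section Coupling.
Variables (R : realType) (d : measure_display) (T : measurableType d).
Variables (P : probability T R) (U : 'I_3 -> {RV P >-> R}).
Hypothesis U_unif : forall (i : 'I_3) (A : set R), measurable A ->
  distribution P (U i) A = uniform_prob (@ltr01 R) A.
Hypothesis U_indep : mutually_independent U.

(** The permutation [s] tells which of the three points falls in which of the cells numbered by the
    triple of [w]. *)
Let ell_cell n (w : 'S_n) (s : 'S_3) : set T :=
  let t := block_triple w in
  \bigcap_(i in [set` [set: 'I_3]%SET])
    (U i @^-1` @cell R n.+1 (triple_nth (val t.1.1, val t.1.2, val t.2) (s i))).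

Lemma measurable_cell N k : measurable (@cell R N k).
Proof. exact: measurable_itv. Qed.

Lemma measurable_ell_cell n (w : 'S_n) s : measurable (ell_cell w s).
Proof.
apply: fin_bigcap_measurable => [|i _]; first exact: finite_finset.
by apply: measurable_funPTI; exact: measurable_cell.
Qed.

Lemma probability_ell_cell n (w : 'S_n) s :
  P (ell_cell w s) = (n.+1%:R ^- 3)%:E.
Proof.
rewrite /ell_cell U_indep; last by move=> i; exact: measurable_cell.
rewrite (eq_bigr (fun _ => (n.+1%:R^-1)%:E)); last first.
  move=> i _; have := U_unif i (measurable_cell n.+1 (triple_nth
    (val (block_triple w).1.1, val (block_triple w).1.2, val (block_triple w).2) (s i))).
  rewrite /distribution /pushforward => ->; rewrite uniform_prob_cell //.
  by move: (block_triple w) (s i) => [[a b] c] [[|[|[|//]]] ?];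
    rewrite /triple_nth /=; exact: ltn_ord.
by rewrite prodEFin prodr_const cardsT card_ord exprVn.
Qed.

(** The sorted points determine the three cells, hence the triple and [w]. The cells being distinct,
    the cell of each point then determines [s]. *)
Lemma ell_cell_inj n (w w' : 'S_n) s s' t :
  w \in bigrassmannian n -> w' \in bigrassmannian n ->
  ell_cell w s t -> ell_cell w' s' t -> (w, s) = (w', s').
Proof.
move=> wB w'B ct ct'.
have /is_block_tripleP[ab bc wE] := bigrassmannian_triple wB.
have /is_block_tripleP[ab' bc' w'E] := bigrassmannian_triple w'B.
rewrite /ell_cell in ct ct'.
move: (block_triple w) (block_triple w') ab bc wE ab' bc' w'E ct ct'.
move=> [[a b] c] [[a' b'] c'] /= ab bc wE ab' bc' w'E ct ct'.
have {}ct i : @cell R n.+1 (triple_nth (val a, val b, val c) (s i)) (U i t).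
  by apply: ct => /=; rewrite finset.in_setT.
have {}ct' i : @cell R n.+1 (triple_nth (val a', val b', val c') (s' i)) (U i t).
  by apply: ct' => /=; rewrite finset.in_setT.
have abc : (a < b < c)%N by rewrite ab.
have abc' : (a' < b' < c')%N by rewrite ab'.
have [x [y [z [e xa yb zc]]]] := sort_cells (ltn0Sn n) abc ct.
have [x' [y' [z' [e' xa' yb' zc']]]] := sort_cells (ltn0Sn n) abc' ct'.
move: e'; rewrite e => -[? ? ?]; subst x' y' z'.
have cell_inj k k' v : @cell R n.+1 k v -> @cell R n.+1 k' v -> k = k'.
  by move=> /cell_truncn <- // /cell_truncn <-.
have ea := cell_inj _ _ _ xa xa'; have eb := cell_inj _ _ _ yb yb'.
have ec := cell_inj _ _ _ zc zc'.
congr (_, _).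
  by rewrite -ea -eb -ec in w'E; exact: is_block_inj wE w'E.
apply/permP => i; have := cell_inj _ _ _ (ct i) (ct' i).
rewrite -[val a']ea -[val b']eb -[val c']ec /= => e2; apply/val_inj.
move: (s i) (s' i) e2 => [[|[|[|//]]] ?] [[|[|[|//]]] ?] //=; rewrite /triple_nth /=; lia.
Qed.

(** Each permutation in [E] gives six disjoint events inside [B], one for each ordering of the
    points, so [P B] is at least [6 * #|S| / (n + 1)^3]. *)
Lemma coupling_lower n (E : pred 'S_n) (B : set T) : (1 < n)%N -> measurable B ->
  (forall w t, w \in bigrassmannian n -> E w ->
     near_spacings n (ell2 w) (ell3 w) (L2 U t) (L3 U t) -> B t) ->
  unif_pr R (bigrassmannian n) E <= fine (P B) + 3 / n%:R.
Proof.
move=> n1 mB EB.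
have nR : 2 <= n%:R :> R by rewrite (ler_nat R 2).
set S := [set w in bigrassmannian n | E w]%SET.
pose D : {set 'S_n * 'S_3} := finset.setX S [set: 'S_3]%SET.
pose F (ws : 'S_n * 'S_3) := ell_cell ws.1 ws.2.
have DB ws : ws \in D -> ws.1 \in bigrassmannian n /\ E ws.1.
  by case: ws => w s /setXP[/setIdP[]].
have mF ws : measurable (F ws) by exact: measurable_ell_cell.
have FB : \bigcup_(ws in [set` D]) F ws `<=` B.
  move=> t [[w s] /DB[/= wB Ew] ct]; apply: (EB w) => //.
  have /is_block_tripleP[ab bc _] := bigrassmannian_triple wB.
  have [-> ->] := ell_triple w; rewrite /F /ell_cell /= in ct.
  move: (block_triple w) ab bc ct => -[[a b] c] /= ab bc ct.
  apply: (@spacings_cells _ _ _ n a b c s) => //; first lia; first lia.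
    by rewrite -ltnS.
  by move=> i; apply: ct => /=; rewrite finset.in_setT.
have tF : trivIset [set` D] F.
  apply/trivIsetP => -[w s] [w' s'] /DB[/= wB _] /DB[/= wB' _] ne.
  rewrite -subset0 => t [ct ct']; case/eqP: ne; exact: ell_cell_inj ct ct'.
have fD : finite_set [set` D] by exact: finite_finset.
have : (P (\bigcup_(ws in [set` D]) F ws) <= P B)%E.
  apply: le_measure => //; rewrite inE //.
  by apply: fin_bigcup_measurable => // ws _; exact: mF.
rewrite measure_fin_bigcup //.
rewrite (eq_fsbigr (fun _ => (n.+1%:R ^- 3)%:E)); last first.
  by move=> ws _; exact: probability_ell_cell.
have -> : [set` D] = [set` enum D] by apply/seteqP; split=> ws /=; rewrite mem_enum.
rewrite -fsbig_seq ?enum_uniq // big_enum /= sumEFin sumr_const.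
have -> : #|D| = (#|S| * 6)%N by rewrite cardsX cardsT card_Sn.
have PB : P B = (fine (P B))%:E by rewrite fineK // fin_num_measure.
rewrite PB lee_fin /= => cellB.
rewrite /unif_pr -/S card_bigrassmannian.
have n30 : 0 < n%:R ^+ 3 - n%:R :> R.
  by rewrite (_ : _ - _ = n%:R * (n%:R - 1) * (n%:R + 1)) ?mulr_gt0 //; [lra..|ring].
have C0 : 0 < 'C(n.+1, 3)%:R :> R by rewrite ltr0n bin_gt0; lia.
have SC : #|S|%:R <= 'C(n.+1, 3)%:R :> R.
  by rewrite ler_nat -card_bigrassmannian subset_leq_card //; apply/fintype.subsetP => w /setIdP[].
set u := _ / _.
have u1 : u <= 1 by rewrite ler_pdivrMr // mul1r.
have u0 : 0 <= u by rewrite divr_ge0.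
have cE : #|S|%:R * 6 = u * (n%:R ^+ 3 - n%:R).
  by rewrite -bin3E /u; field; rewrite gt_eqF.
move: cellB; rewrite -[_ *+ (_ * 6)]mulr_natl natrM cE -natr1.
clear cE; move: (n%:R : R) nR n30 u u1 u0 (fine (P B)); clear => n n2 n30 u u1 u0 b ub.
(* The part of the space not covered by any cell event has mass [(3 * n + 1) / (n + 1)^2]. *)
have e : 1 - (n ^+ 3 - n) / (n + 1) ^+ 3 <= 3 / n.
  rewrite -subr_ge0.
  rewrite (_ : _ - _ = (5 * n + 3) / (n * (n + 1) ^+ 2)); last by field; lra.
  by rewrite divr_ge0 ?mulr_ge0 ?exprn_ge0 //; lra.
have e2 : u * (1 - (n ^+ 3 - n) / (n + 1) ^+ 3) <= 1 - (n ^+ 3 - n) / (n + 1) ^+ 3.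
  rewrite ler_piMl // -subr_ge0.
  rewrite (_ : _ - _ = (3 * n + 1) / (n + 1) ^+ 2); last by field; lra.
  by rewrite divr_ge0 ?exprn_ge0 //; lra.
have e3 : u * (n ^+ 3 - n) / (n + 1) ^+ 3 <= b by [].
by lra.
Qed.

(** This is the lower bound applied to the complements of [E] and [B]. *)
Lemma coupling_upper n (E : pred 'S_n) (B : set T) : (1 < n)%N -> measurable B ->
  (forall w t, w \in bigrassmannian n -> B t ->
     near_spacings n (ell2 w) (ell3 w) (L2 U t) (L3 U t) -> E w) ->
  fine (P B) <= unif_pr R (bigrassmannian n) E + 3 / n%:R.
Proof.
move=> n1 mB BE.
have /(coupling_lower n1 (measurableC mB)) : (forall w t, w \in bigrassmannian n -> ~~ E w ->
    near_spacings n (ell2 w) (ell3 w) (L2 U t) (L3 U t) -> (~` B) t).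
  by move=> w t wB /negP nE near Bt; apply: nE; apply: BE near.
rewrite probability_setC //.
have PB : P B = (fine (P B))%:E by rewrite fineK // fin_num_measure.
rewrite [in X in X -> _]PB -EFinB /=.
have -> : unif_pr R (bigrassmannian n) (fun w => ~~ E w) =
    1 - unif_pr R (bigrassmannian n) E.
  have C0 : 0 < #|bigrassmannian n|%:R :> R.
    by rewrite card_bigrassmannian ltr0n bin_gt0; lia.
  rewrite /unif_pr; apply: (mulIf (lt0r_neq0 C0)).
  rewrite mulrBl !divfK ?lt0r_neq0 // mul1r; apply/eqP; rewrite eq_sym subr_eq -natrD; apply/eqP.
  congr (_%:R); rewrite -(cardsID [set w | E w]%SET (bigrassmannian n)) addnC.
  by congr (_ + _)%N; apply: eq_card => w; rewrite !finset.inE // andbC.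
by lra.
Qed.

End Coupling.

(** * The limit density *)

Section DensityIntegral.
Variable R : realType.
Local Notation mu := (@lebesgue_measure R).
Implicit Types x y c : R.

(** Squaring removes the kink of the positive part: the first-order remainder is at most [h^2] in
    each sign case. *)
Lemma is_derive_pospart_sqr c x :
  is_derive x 1 (fun t : R => Num.max 0 (c - t) ^+ 2) (- (2 * Num.max 0 (c - x))).
Proof.
set f := fun t : R => _.
have : h^-1 *: (f (h *: (1 : R) + x) - f x) @[h --> (0 : R)^'] --> - (2 * Num.max 0 (c - x)).
  apply/cvgrPdist_le => /= e e0; near=> h.
  have h0 : h != 0 by near: h; exact: nbhs_dnbhs_neq.
  have he : `|h| <= e.
    near: h; apply: nbhs_dnbhs; apply/nbhs_normP; exists e => //= z /=.
    by rewrite sub0r normrN => /ltW.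
  apply: le_trans he.
  have -> : - (2 * Num.max 0 (c - x)) - h^-1 *: (f (h *: (1 : R) + x) - f x) =
     (- (2 * Num.max 0 (c - x)) * h - (f (h + x) - f x)) / h.
    by rewrite /GRing.scale /= mulr1; field.
  rewrite normrM normfV ler_pdivrMr ?normr_gt0 // -normrM ler_norml /f.
  have hh : `|h * h| = h * h by rewrite ger0_norm // -expr2 sqr_ge0.
  rewrite hh !maxEle; do 2 case: ifP => ?; apply/andP; split; rewrite ?expr2; nra.
move=> cv; apply: DeriveDef; first by apply/cvg_ex; exists (- (2 * Num.max 0 (c - x))).
exact: (cvg_lim _ cv).
Unshelve. all: by end_near. Qed.

Lemma is_derive_pospart_cube c x :
  is_derive x 1 (fun t : R => Num.max 0 (c - t) ^+ 3) (- (3 * Num.max 0 (c - x) ^+ 2)).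
Proof.
have -> : (fun t : R => Num.max 0 (c - t) ^+ 3) =
    (fun t => c - t) * (fun t => Num.max 0 (c - t) ^+ 2).
  apply/funext => t; change (Num.max 0 (c - t) ^+ 3 = (c - t) * Num.max 0 (c - t) ^+ 2).
  by rewrite !maxEle; case: ifP => ?; ring.
have d2 := is_derive_pospart_sqr c x.
have d1 : is_derive x 1 (fun t => c - t) (- 1).
  by apply: is_derive_eq; rewrite add0r mul1r.
apply: is_derive_eq.
rewrite /GRing.scale /= !maxEle; case: ifP => ?; ring.
Qed.

Lemma continuous_pospart c : continuous (fun t : R => Num.max 0 (c - t)).
Proof.
move=> x; apply: (@continuous_max _ _ (cst 0) (fun t => c - t)); first exact: cvg_cst.
by apply: cvgB; [exact: cvg_cst | exact: cvg_id].
Qed.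

Lemma integral_derive (f F : R -> R) (a b : R) : a < b -> continuous f ->
  (forall x, is_derive x 1 F (f x)) ->
  (\int[mu]_(x in `]a, b[) (f x)%:E = (F b - F a)%R%:E)%E.
Proof.
move=> ab cf dF.
have cF : continuous F.
  by move=> x; apply/differentiable_continuous/derivable1_diffP; have [] := dF x.
have mf : measurable_fun [set: R] f by exact: continuous_measurable_fun.
rewrite -(@integral_itv_bndoo _ a b (EFin \o f) true false).
  rewrite (@continuous_FTC2 _ f F) //.
  - exact: continuous_subspaceT.
  - split; first by move=> x _; have [] := dF x.
    + by apply: cvg_at_right_filter; exact: cF.
    + by apply: cvg_at_left_filter; exact: cF.
  - by move=> x _; rewrite derive1E; have [_ ->] := dF x.
by apply/measurable_EFinP; apply: measurable_funS mf.
Qed.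

(** Replacing [1 - x - y] by its positive part absorbs the constraint [x + y < 1], which leaves an
    iterated integral over a full rectangle. *)
Lemma integral_rect_mass (i0 i1 j0 j1 : R) :
  0 <= i0 -> i0 < i1 -> 0 <= j0 -> j0 < j1 ->
  (\int[mu \x mu]_(z in [set z : R * R |
       [/\ (i0 < z.1 < i1)%R, (j0 < z.2 < j1)%R & (0 < z.1 + z.2 < 1)%R]])
     (6 * (1 - z.1 - z.2))%:E)%E = (rect_mass i0 i1 j0 j1)%:E.
Proof.
move=> i00 i01 j00 j01.
pose f (z : R * R) : \bar R := (6 * Num.max 0 (1 - z.1 - z.2))%:E.
pose A : set (R * R) := `]i0, i1[%classic `*` `]j0, j1[%classic.
have mA : measurable A by apply: measurableX; exact: measurable_itv.
have mf : measurable_fun setT f.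
  apply/measurable_EFinP; apply: measurable_funM => //; apply: measurable_maxr => //.
  by apply: measurable_funB => //; apply: measurable_funB.
have f0 z : (0 <= f z)%E by rewrite lee_fin mulr_ge0 // le_max lexx.
rewrite integral_mkcond.
transitivity (\int[mu \x mu]_z (f \_ A) z)%E.
  apply: eq_integral => -[x y] _; rewrite /patch.
  case: ifPn => [|]; case: ifPn => [|] //=.
  - rewrite !inE /= => _ [_ _ xy]; rewrite /f /=; congr (6 * _)%:E.
    by rewrite max_r //; lra.
  - by rewrite notin_setE inE /A /= !in_itv /= => nA [? ? _]; case: nA.
  - rewrite notin_setE inE /A /= !in_itv /= => -[hx hy] nB; rewrite /f /=.
    rewrite max_l ?mulr0 //; have [xy|] := ltP (x + y) 1; last by lra.
    by case: nB; split=> //; lra.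
rewrite fubini_tonelli1; last 2 first.
- exact/(measurable_restrictT _ mA)/measurable_funTS.
- by move=> z; apply: erestrict_ge0.
rewrite /fubini_F.
transitivity (\int[mu]_(x in `]i0, i1[)
   (3 * Num.max 0 (1 - j0 - x) ^+ 2 - 3 * Num.max 0 (1 - j1 - x) ^+ 2)%:E)%E; last first.
  pose g (x : R) : R := 3 * Num.max 0 (1 - j0 - x) ^+ 2 - 3 * Num.max 0 (1 - j1 - x) ^+ 2.
  (* The outer antiderivative; its values at [i0] and [i1] are the four corner terms. *)
  pose G (x : R) : R := Num.max 0 (1 - j1 - x) ^+ 3 - Num.max 0 (1 - j0 - x) ^+ 3.
  have cg : continuous g.
    by move=> x; apply: cvgB; (apply: cvgM; first exact: cvg_cst); apply: cvgM;
      exact: continuous_pospart.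
  have dG (x : R) : is_derive x 1 G (g x).
    have d0 := is_derive_pospart_cube (1 - j0) x.
    have d1 := is_derive_pospart_cube (1 - j1) x.
    by apply: is_derive_eq; rewrite /g; ring.
  rewrite (@integral_derive g G _ _ i01 cg dG) /rect_mass /survival /G.
  rewrite ![1 - i0 - _]addrAC ![1 - i1 - _]addrAC; congr (_%:E); ring.
rewrite [RHS]integral_mkcond; apply: eq_integral => x _; rewrite [RHS]/patch.
have [xI|xI] := boolP (x \in `]i0, i1[%classic).
  pose g (y : R) : R := 6 * Num.max 0 (1 - x - y).
  pose G (y : R) : R := - (3 * Num.max 0 (1 - x - y) ^+ 2).
  have cg : continuous g by move=> y; apply: cvgM; [exact: cvg_cst | exact: continuous_pospart].
  have dG (y : R) : is_derive y 1 G (g y).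
    have d0 := is_derive_pospart_sqr (1 - x) y.
    by apply: is_derive_eq; rewrite /g /GRing.scale /=; ring.
  transitivity (\int[mu]_(y in `]j0, j1[) (g y)%:E)%E; last first.
    rewrite (@integral_derive g G _ _ j01 cg dG) /G.
    by rewrite ![1 - x - _]addrAC; congr (_%:E); ring.
  rewrite [RHS]integral_mkcond; apply: eq_integral => y _; rewrite /patch.
  congr (if _ then _ else _); apply/idP/idP; rewrite !inE /A /= !in_itv /=.
    by case.
  by move=> hy; split=> //; move: xI; rewrite inE /= in_itv.
rewrite integral0_eq // => y _; rewrite /patch ifF //; apply/negbTE.
by apply: contra xI; rewrite !inE /A /=; case.
Qed.

End DensityIntegral.

(** * Limits *)

Section SpacingsMeasurability.
Variables (R : realType) (d : measure_display) (T : measurableType d).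
Variables (P : probability T R) (U : 'I_3 -> {RV P >-> R}).

(** Writing the middle value as the sum minus the two extremes expresses all order statistics by
    measurable operations. *)
Lemma sort_three (x y z : R) : sort <=%R [:: x; y; z] =
  let m := Num.min x (Num.min y z) in let M := Num.max x (Num.max y z) in
  [:: m; x + y + z - m - M; M].
Proof.
have sortE (a b c : R) : a <= b -> b <= c -> perm_eq [:: x; y; z] [:: a; b; c] ->
    sort <=%R [:: x; y; z] = [:: a; b; c].
  move=> ab bc xyz; apply: (sorted_eq le_trans le_anti); rewrite ?sort_le_sorted //.
    by rewrite /= ab bc.
  by rewrite perm_sort.
have e1 (a b c : R) : a + b + c - a - c = b by ring.
have e2 (a b c : R) : a + b + c - a - b = c by ring.
have e3 (a b c : R) : a + b + c - b - c = a by ring.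
have e4 (a b c : R) : a + b + c - b - a = c by ring.
have e5 (a b c : R) : a + b + c - c - a = b by ring.
have e6 (a b c : R) : a + b + c - c - b = a by ring.
cbv zeta; case: (leP y z) => yz.
- case: (leP x y) => xy.
    have xz := le_trans xy yz; rewrite (max_r xz) e1.
    by apply: sortE.
  case: (leP x z) => xz.
    by rewrite e3; apply: sortE => //; [exact: ltW | apply/seq.permP => p /=; lia].
  by rewrite e4; apply: sortE => //; [exact: ltW | apply/seq.permP => p /=; lia].
- case: (leP x z) => xz.
    have xy := le_trans xz (ltW yz); rewrite (max_r xy) e2.
    by apply: sortE => //; [exact: ltW | apply/seq.permP => p /=; lia].
  case: (leP x y) => xy.
    by rewrite e6; apply: sortE => //; [exact: ltW | apply/seq.permP => p /=; lia].
  by rewrite e5; apply: sortE => //; [exact: ltW | exact: ltW | apply/seq.permP => p /=; lia].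
Qed.

Let order_stats t : sort <=%R [seq U i t | i <- enum 'I_3] =
  let x := U ord0 t in let y := U (lift ord0 ord0) t in
  let z := U (lift ord0 (lift ord0 ord0)) t in
  let m := Num.min x (Num.min y z) in let M := Num.max x (Num.max y z) in
  [:: m; x + y + z - m - M; M].
Proof.
rewrite !enum_ordSl (_ : enum 'I_0 = [::]) ?sort_three //.
by apply: size0nil; rewrite size_enum_ord.
Qed.

Let measurable_extreme_order_stats :
  measurable_fun setT (fun t => order_stat U 0 t) /\
  measurable_fun setT (fun t => order_stat U 2 t).
Proof.
by rewrite /order_stat; split; under eq_fun do rewrite order_stats /=;
  [apply: measurable_minr => //; apply: measurable_minr |
   apply: measurable_maxr => //; apply: measurable_maxr].
Qed.

Let measurable_middle_order_stat : measurable_fun setT (fun t => order_stat U 1 t).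
Proof.
rewrite /order_stat; under eq_fun do rewrite order_stats /=.
apply: measurable_funB; first apply: measurable_funB.
- by apply: measurable_funD => //; apply: measurable_funD.
- by apply: measurable_minr => //; apply: measurable_minr.
- by apply: measurable_maxr => //; apply: measurable_maxr.
Qed.

Lemma measurable_L2 : measurable_fun setT (L2 U).
Proof. by apply: measurable_funB => //; case: measurable_extreme_order_stats. Qed.

Lemma measurable_L3 : measurable_fun setT (L3 U).
Proof. by apply: measurable_funB => //; case: measurable_extreme_order_stats. Qed.

End SpacingsMeasurability.

(** * Convergence in distribution and the rate on rectangles *)

Section Limits.
Variables (R : realType) (d : measure_display) (T : measurableType d).
Variables (P : probability T R) (U : 'I_3 -> {RV P >-> R}).
Hypothesis U_unif : forall (i : 'I_3) (A : set R), measurable A ->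
  distribution P (U i) A = uniform_prob (@ltr01 R) A.
Hypothesis U_indep : mutually_independent U.

(** The threshold is the ceiling of [y]; it turns a strict real bound on an integer into one in
    [nat]. *)
Lemma lt_nat_threshold (y : R) : 0 <= y ->
  exists2 s : nat, (forall k : nat, (k%:R < y) = (k < s)%N) & `|s%:R - y| <= 1.
Proof.
move=> y0; have ex : exists s, y <= s%:R.
  by exists (Num.truncn y).+1; apply: ltW; exact: truncnS_gt.
case: (ex_minnP ex) => s ys smin; exists s.
  move=> k; rewrite ltNge ltnNge; congr (~~ _); apply/idP/idP => [/smin//|sk].
  by apply: le_trans ys _; rewrite ler_nat.
have : s%:R < y + 1.
  case: (s) smin => [|s'] smin; first by lra.
  rewrite -natr1 ltrD2r ltNge; apply/negP => /smin; lia.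
by rewrite ler_norml; lra.
Qed.

Lemma gt_nat_threshold (y : R) : 0 <= y ->
  exists2 s : nat, (forall k : nat, (y < k%:R) = (s < k)%N) & `|s%:R - y| <= 1.
Proof.
move=> y0; exists (Num.truncn y); first by move=> k; rewrite truncn_lt_nat.
by have := truncn_itv y0; rewrite -natr1 ler_norml; lra.
Qed.

Lemma bigrassmannian_ell_gt0 n (w : 'S_n) : w \in bigrassmannian n ->
  (0 < ell2 w)%N /\ (0 < ell3 w)%N.
Proof.
move=> /bigrassmannian_triple/is_block_tripleP[ab bc _].
by have [-> ->] := ell_triple w; rewrite !subn_gt0.
Qed.

(** Not a probability density: the function of the two spacings whose law is the limit. *)
Let limit_density (x y : R) : R := 2^-1 * x * y * (x + y).

Lemma beta_near (n : nat) (w : 'S_n) (x y : R) : (1 < n)%N -> w \in bigrassmannian n ->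
  near_spacings n (ell2 w) (ell3 w) x y ->
  `|(beta w)%:R / n%:R ^+ 3 - limit_density x y| <= 20 / n%:R.
Proof.
move=> n1 wB [x01 y01 hx hy].
have nR : 2 <= n%:R :> R by rewrite (ler_nat R 2).
have -> : (beta w)%:R / n%:R ^+ 3 = limit_density ((ell2 w)%:R / n%:R) ((ell3 w)%:R / n%:R).
  have := beta_bigrassmannian wB => /(congr1 (fun k => k%:R : R)).
  rewrite !natrM natrD => e; apply: (mulfI (x := 2)) => //.
  by rewrite mulrA e /limit_density; field; lra.
have u0 : 0 <= (ell2 w)%:R / n%:R :> R by rewrite divr_ge0.
have v0 : 0 <= (ell3 w)%:R / n%:R :> R by rewrite divr_ge0.
have e1 : 2 / n%:R <= 1 :> R by rewrite ler_pdivrMr; lra.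
have -> : 20 / n%:R = 10 * (2 / n%:R) :> R by rewrite mulrA; congr (_ * _); ring.
move: (_ / _) ((ell3 w)%:R / _) (2 / _) hx hy u0 v0 e1 => u v e hx hy u0 v0 e1.
have e0 : 0 <= e by apply: le_trans hx.
have u2 : u <= 2 by move: hx; rewrite ler_norml; lra.
have v2 : v <= 2 by move: hy; rewrite ler_norml; lra.
(* Factoring out [u - x] and [v - y] leaves cofactors of at most 5, as [u] and [v] are at most 2;
   hence the constant [2 * 5 * 2 = 20]. *)
have -> : limit_density u v - limit_density x y =
   (u - x) * (2^-1 * ((u + x) * v + v * v)) + (v - y) * (2^-1 * (x * x + x * (v + y))).
  by rewrite /limit_density; field.
apply: le_trans (ler_normD _ _) _; rewrite !normrM.
have b1 : `|2^-1 * ((u + x) * v + v * v)| <= 5 by rewrite ger0_norm; nra.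
have b2 : `|2^-1 * (x * x + x * (v + y))| <= 5 by rewrite ger0_norm; nra.
rewrite -!normrM [10 * e](_ : _ = e * 5 + e * 5); last by ring.
by apply: lerD; rewrite normrM; apply: ler_pM.
Qed.

Let cdf (x : R) : R := fine (P [set t | 2^-1 * L2 U t * L3 U t * (L2 U t + L3 U t) <= x]).

Let measurable_sublevel x :
  measurable [set t | 2^-1 * L2 U t * L3 U t * (L2 U t + L3 U t) <= x].
Proof.
have m2 := measurable_L2 U; have m3 := measurable_L3 U.
rewrite -[X in measurable X]setTI; apply: measurable_fun_le => //.
by apply: measurable_funM; [do 2 apply: measurable_funM => // | apply: measurable_funD].
Qed.

(** The coupling moves values by at most [20 / n] and probabilities by at most [3 / n]. The discrete
    distribution function is thus squeezed between values of [cdf] at [x - 20 / n] and [x + 20 / n],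
    and continuity at [x] concludes. *)
Lemma cvg_beta : cvg_in_distribution
  (fun (n : nat) (x : R) => unif_pr R (bigrassmannian n)
     (fun w => (beta w)%:R / n%:R ^+ 3 <= x)) cdf.
Proof.
move=> x cx; apply/cvgrPdist_le => e e0.
have e20 : 0 < e / 2 by rewrite divr_gt0.
have /cvgr_dist_le/(_ _ e20) [del del0 cxd] := cx.
have near_cdf (h : R) : `|h| < del -> `|cdf x - cdf (x + h)| <= e / 2.
  by move=> hd; apply: cxd => /=; rewrite opprD addrA subrr sub0r normrN.
near=> n.
have n1 : (1 < n)%N by near: n; exact: nbhs_infty_gt.
have nR : 2 <= n%:R :> R by rewrite (ler_nat R 2).
have n0 : 0 < n%:R :> R by lra.
have nd : 20 / n%:R < del.
  by rewrite ltr_pdivrMr // mulrC -ltr_pdivrMr //; near: n; exact: nbhs_infty_gtr.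
have ne : 3 / n%:R <= e / 2.
  by rewrite ler_pdivrMr // mulrC -ler_pdivrMr // ltW //; near: n; exact: nbhs_infty_gtr.
have h0 : 0 <= 20 / n%:R :> R by rewrite divr_ge0.
have up := near_cdf (20 / n%:R); have dn := near_cdf (- (20 / n%:R)).
rewrite normrN in dn; rewrite (ger0_norm h0) in up dn.
have {}up := up nd; have {}dn := dn nd.
have lo : unif_pr R (bigrassmannian n) (fun w => (beta w)%:R / n%:R ^+ 3 <= x) <=
    cdf (x + 20 / n%:R) + 3 / n%:R.
  apply: (coupling_lower U_unif U_indep n1) => // w t wB /= bx near.
  have := beta_near n1 wB near; rewrite /limit_density /= ler_norml.
  by move: bx; set g := _ * (_ + _); lra.
have hi : cdf (x - 20 / n%:R) <=
    unif_pr R (bigrassmannian n) (fun w => (beta w)%:R / n%:R ^+ 3 <= x) + 3 / n%:R.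
  apply: (coupling_upper U_unif U_indep n1) => // w t wB /= bx near.
  have := beta_near n1 wB near; rewrite /limit_density /= ler_norml.
  by move: bx; set g := _ * (_ + _); lra.
by move: up dn; rewrite !ler_norml; lra.
Unshelve. all: by end_near. Qed.

Variables (i0 i1 j0 j1 : R).
Hypotheses (i00 : 0 <= i0) (i01 : i0 < i1) (j00 : 0 <= j0) (j01 : j0 < j1).

Let i10 : 0 <= i1 := ltW (le_lt_trans i00 i01).
Let j10 : 0 <= j1 := ltW (le_lt_trans j00 j01).

Lemma unif_pr_spacings n : (1 < n)%N ->
  `|unif_pr R (bigrassmannian n)
     (fun w => (n%:R * i0 < (ell2 w)%:R < n%:R * i1) &&
               (n%:R * j0 < (ell3 w)%:R < n%:R * j1)) - rect_mass i0 i1 j0 j1|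
  <= 200 / n%:R.
Proof.
move=> n1; have nR : 2 <= n%:R :> R by rewrite (ler_nat R 2).
have n0 : 0 <= n%:R :> R by [].
have [s0 s0P hs0] := gt_nat_threshold (mulr_ge0 n0 i00).
have [s1 s1P hs1] := lt_nat_threshold (mulr_ge0 n0 i10).
have [t0 t0P ht0] := gt_nat_threshold (mulr_ge0 n0 j00).
have [t1 t1P ht1] := lt_nat_threshold (mulr_ge0 n0 j10).
have s01 : (s0 < s1)%N.
  rewrite -s1P; apply: (@le_lt_trans _ _ (n%:R * i0));
    last by rewrite ltr_pM2l // (lt_le_trans _ nR).
  by rewrite leNgt s0P ltnn.
have t01 : (t0 < t1)%N.
  rewrite -t1P; apply: (@le_lt_trans _ _ (n%:R * j0));
    last by rewrite ltr_pM2l // (lt_le_trans _ nR).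
  by rewrite leNgt t0P ltnn.
(* In integers the open interval starts at [s0 + 1], one above the floor, and stops before the
   ceiling [s1]. *)
have -> : (fun w : 'S_n => (n%:R * i0 < (ell2 w)%:R < n%:R * i1) &&
               (n%:R * j0 < (ell3 w)%:R < n%:R * j1)) =
    (fun w => (s0.+1 <= ell2 w < s1)%N && (t0.+1 <= ell3 w < t1)%N).
  by apply/funext => w; rewrite s0P s1P t0P t1P.
by apply: unif_pr_rect; rewrite ?s01 ?t01 -?natr1 //; move: hs0 hs1 ht0 ht1;
  rewrite !ler_norml; lra.
Qed.

Let spacings_event := [set t | (i0 < L2 U t < i1) && (j0 < L3 U t < j1)].

Let measurable_spacings_event : measurable spacings_event.
Proof.
have m2 := measurable_L2 U; have m3 := measurable_L3 U.
have mI (f : T -> R) (a b : R) : measurable_fun setT f ->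
    measurable [set t | a < f t < b].
  move=> mf; have := mf measurableT `]a, b[%classic (measurable_itv _).
  by rewrite setTI; congr measurable; apply/funext => t; rewrite /= in_itv.
rewrite (_ : spacings_event = [set t | i0 < L2 U t < i1] `&` [set t | j0 < L3 U t < j1]).
  by apply: measurableI; exact: mI.
apply/seteqP; split=> t; rewrite /spacings_event /=; first by move=> /andP[].
by move=> [-> ->].
Qed.

Lemma near_spacings_scale n p q (x y : R) : (1 < n)%N -> near_spacings n p q x y ->
  `|p%:R - n%:R * x| <= 2 /\ `|q%:R - n%:R * y| <= 2.
Proof.
move=> n1 [_ _ hx hy]; have nR : 0 < n%:R :> R by rewrite ltr0n; lia.
have E (r v : R) : r / n%:R - v = (r - n%:R * v) / n%:R by field; rewrite gt_eqF.
move: hx hy; rewrite !E !normrM !normfV (gtr0_norm nR) !ler_pM2r ?invr_gt0 //.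
Qed.

Lemma probability_spacings_near n : (1 < n)%N ->
  7 <= n%:R * (i1 - i0) -> 7 <= n%:R * (j1 - j0) ->
  `|fine (P spacings_event) - rect_mass i0 i1 j0 j1| <= 203 / n%:R.
Proof.
move=> n1 ni nj; have nR : 2 <= n%:R :> R by rewrite (ler_nat R 2).
have n0 : 0 <= n%:R :> R by [].
have np : 0 < n%:R :> R by rewrite (lt_le_trans _ nR).
rewrite mulrBr in ni; rewrite mulrBr in nj.
have [s0 s0P hs0] := gt_nat_threshold (mulr_ge0 n0 i00).
have [s1 s1P hs1] := lt_nat_threshold (mulr_ge0 n0 i10).
have [t0 t0P ht0] := gt_nat_threshold (mulr_ge0 n0 j00).
have [t1 t1P ht1] := lt_nat_threshold (mulr_ge0 n0 j10).
have natR (k l : nat) : (k + 5 <= l)%N = (k%:R + 5 <= l%:R :> R) by rewrite -natrD ler_nat.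
move: hs0 hs1 ht0 ht1; rewrite !ler_norml => hs0 hs1 ht0 ht1.
(* A width of 7 loses at most 2 by rounding; the remaining 5 is what the inner bounds [s0 + 3] and
   [s1 - 2] need. *)
have s01 : (s0 + 5 <= s1)%N by rewrite natR; lra.
have t01 : (t0 + 5 <= t1)%N by rewrite natR; lra.
have s0le : s0%:R <= n%:R * i0 by rewrite leNgt s0P ltnn.
have t0le : t0%:R <= n%:R * j0 by rewrite leNgt t0P ltnn.
have E203 : 203 / n%:R = 200 / n%:R + 3 / n%:R :> R by rewrite -mulrDl; congr (_ / _); ring.
(* The sides of the rectangle are moved by the coupling error [2 / n] and then
   rounded to integers. *)
have lo : rect_mass i0 i1 j0 j1 - 200 / n%:R <= fine (P spacings_event) + 3 / n%:R.
  have [s21 t21] : (2 <= s1 /\ 2 <= t1)%N by move: s01 t01; clear; lia.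
  have s1B : (s1 - 2)%:R = s1%:R - 2 :> R by rewrite natrB.
  have t1B : (t1 - 2)%:R = t1%:R - 2 :> R by rewrite natrB.
  have sI : (0 < s0 + 3 <= s1 - 2)%N by move: s01; clear; lia.
  have tI : (0 < t0 + 3 <= t1 - 2)%N by move: t01; clear; lia.
  have : `|unif_pr R (bigrassmannian n) (fun w => (s0 + 3 <= ell2 w < s1 - 2)%N &&
      (t0 + 3 <= ell3 w < t1 - 2)%N) - rect_mass i0 i1 j0 j1| <= 200 / n%:R.
    by apply: unif_pr_rect; rewrite // ?s1B ?t1B ?natrD ler_norml; lra.
  have : unif_pr R (bigrassmannian n) (fun w => (s0 + 3 <= ell2 w < s1 - 2)%N &&
      (t0 + 3 <= ell3 w < t1 - 2)%N) <= fine (P spacings_event) + 3 / n%:R.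
    apply: (coupling_lower U_unif U_indep n1) => // w t wB /andP[hp hq].
    move=> /(near_spacings_scale n1)[]; rewrite !ler_norml => h2 h3.
    have c1 : n%:R * i0 < (ell2 w - 2)%:R by rewrite s0P; move: hp; clear; lia.
    have c2 : (ell2 w + 2)%:R < n%:R * i1 by rewrite s1P; move: hp; clear; lia.
    have c3 : n%:R * j0 < (ell3 w - 2)%:R by rewrite t0P; move: hq; clear; lia.
    have c4 : (ell3 w + 2)%:R < n%:R * j1 by rewrite t1P; move: hq; clear; lia.
    have [l2 l3] : (2 <= ell2 w /\ 2 <= ell3 w)%N by move: hp hq; clear; lia.
    rewrite natrB // in c1; rewrite natrB // in c3; rewrite natrD in c2; rewrite natrD in c4.
    rewrite /spacings_event /= -(ltr_pM2l np i0) -(ltr_pM2l np _ i1).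
    rewrite -(ltr_pM2l np j0) -(ltr_pM2l np _ j1).
    by apply/andP; split; lra.
  by rewrite ler_norml; lra.
have hi : fine (P spacings_event) <= rect_mass i0 i1 j0 j1 + 200 / n%:R + 3 / n%:R.
  have sub2 k : (k%:R - 2 <= (k - 2)%:R :> R) /\ ((k - 2)%:R <= k%:R :> R).
    split; last by rewrite ler_nat leq_subr.
    by rewrite lerBlDr -natrD ler_nat; clear; lia.
  (* The truncated subtraction and the successor keep the lower bound positive, as the lengths
     themselves are. *)
  have sI : (0 < (s0 - 2).+1 <= s1 + 2)%N by move: s01; clear; lia.
  have tI : (0 < (t0 - 2).+1 <= t1 + 2)%N by move: t01; clear; lia.
  have : `|unif_pr R (bigrassmannian n) (fun w => ((s0 - 2).+1 <= ell2 w < s1 + 2)%N &&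
      ((t0 - 2).+1 <= ell3 w < t1 + 2)%N) - rect_mass i0 i1 j0 j1| <= 200 / n%:R.
    have [? ?] := sub2 s0; have [? ?] := sub2 t0.
    apply: unif_pr_rect => //.
    - by rewrite -natr1 ler_norml; lra.
    - by rewrite natrD ler_norml; lra.
    - by rewrite -natr1 ler_norml; lra.
    - by rewrite natrD ler_norml; lra.
  have : fine (P spacings_event) <=
    unif_pr R (bigrassmannian n) (fun w => ((s0 - 2).+1 <= ell2 w < s1 + 2)%N &&
      ((t0 - 2).+1 <= ell3 w < t1 + 2)%N) + 3 / n%:R.
    apply: (coupling_upper U_unif U_indep n1) => // w t wB.
    move=> /andP[/andP[c1 c2] /andP[c3 c4]].
    move=> /(near_spacings_scale n1)[]; rewrite !ler_norml => h2 h3.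
    have [p0 q0] := bigrassmannian_ell_gt0 wB.
    rewrite -(ltr_pM2l np) in c1; rewrite -(ltr_pM2l np) in c2.
    rewrite -(ltr_pM2l np) in c3; rewrite -(ltr_pM2l np) in c4.
    have k1 : (s0 < ell2 w + 2)%N by rewrite -s0P natrD; lra.
    have k2 : (t0 < ell3 w + 2)%N by rewrite -t0P natrD; lra.
    have k3 : ((ell2 w)%:R - 2 < n%:R * i1 :> R) by lra.
    have k4 : ((ell3 w)%:R - 2 < n%:R * j1 :> R) by lra.
    have below2 (k s : nat) (y : R) : (forall k : nat, (k%:R < y) = (k < s)%N) ->
        k%:R - 2 < y -> (k < s + 2)%N.
      move=> sP ky; case: (ltnP k 2) => [k2'|k2']; first by rewrite ltn_addl.
      by have := sP (k - 2)%N; rewrite natrB // ky ltn_subLR // addnC.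
    by rewrite (below2 _ _ _ s1P k3) (below2 _ _ _ t1P k4); move: k1 k2 p0 q0; clear; lia.
  by rewrite ler_norml; lra.
by rewrite E203; lra.
Qed.

(** Neither side depends on [n], and they differ by at most [203 / n] for all large [n]. *)
Lemma probability_spacings : P spacings_event = (rect_mass i0 i1 j0 j1)%:E.
Proof.
have PB : P spacings_event = (fine (P spacings_event))%:E by rewrite fineK // fin_num_measure.
rewrite PB; congr (_%:E); apply/eqP; rewrite -subr_eq0 -normr_le0; apply/ler_addgt0Pl => e e0.
near \oo => n.
rewrite addr0; apply: (@le_trans _ _ (203 / n%:R)).
  apply: probability_spacings_near; first by near: n; exact: nbhs_infty_gt.
    by rewrite -ler_pdivrMr ?subr_gt0 // ltW //; near: n; exact: nbhs_infty_gtr.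
  by rewrite -ler_pdivrMr ?subr_gt0 // ltW //; near: n; exact: nbhs_infty_gtr.
have n0 : 0 < n%:R :> R by near: n; exact: nbhs_infty_gtr.
by rewrite ler_pdivrMr // mulrC -ler_pdivrMr // ltW //; near: n; exact: nbhs_infty_gtr.
Unshelve. all: by end_near. Qed.

End Limits.

Theorem theorem1p4 (R : realType) (d : measure_display) (T : measurableType d)
    (P : probability T R) (U : 'I_3 -> {RV P >-> R})
    (U_unif : forall (i : 'I_3) (A : set R), measurable A ->
       distribution P (U i) A = uniform_prob (@ltr01 R) A)
    (U_indep : mutually_independent U) :
  cvg_in_distribution
    (fun (n : nat) (x : R) =>
       unif_pr R (bigrassmannian n)
         (fun w => (beta w)%:R / n%:R ^+ 3 <= x))
    (fun x : R =>
       fine (P [set t | 2^-1 * L2 U t * L3 U t * (L2 U t + L3 U t) <= x]))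
  /\
  forall i0 i1 j0 j1 : R,
    0 <= i0 -> i0 < i1 -> i1 <= 1 -> 0 <= j0 -> j0 < j1 -> j1 <= 1 ->
    let p (n : nat) : R :=
      unif_pr R (bigrassmannian n)
        (fun w => (n%:R * i0 < (ell2 w)%:R < n%:R * i1) &&
                  (n%:R * j0 < (ell3 w)%:R < n%:R * j1)) in
    let q : \bar R :=
      (\int[lebesgue_measure \x lebesgue_measure]_(z in
          [set z : R * R | [/\ i0 < z.1 < i1, j0 < z.2 < j1 &
                               0 < z.1 + z.2 < 1]%R])
         (6 * (1 - z.1 - z.2))%:E)%E in
    [/\ (p n)%:E @[n --> \oo] --> q,
        q = P [set t | (i0 < L2 U t < i1) && (j0 < L3 U t < j1)] &
        (fun n : nat => p n - fine q) =O_\oo (fun n : nat => n%:R^-1 : R)].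
Proof.
split; first exact: cvg_beta U_unif U_indep.
move=> i0 i1 j0 j1 i00 i01 _ j00 j01 _ p q.
have qE : q = (rect_mass i0 i1 j0 j1)%:E by exact: integral_rect_mass.
(* This explicit bound gives both the limit and the error term of order [1 / n]. *)
have pq n : (1 < n)%N -> `|p n - rect_mass i0 i1 j0 j1| <= 200 / n%:R.
  exact: unif_pr_spacings.
rewrite qE; split.
- apply: cvg_EFin; first by near=> n.
  apply/cvgrPdist_le => e e0; near=> n.
  rewrite distrC; apply: le_trans (pq n _) _; first by near: n; exact: nbhs_infty_gt.
  have n0 : 0 < n%:R :> R by near: n; exact: nbhs_infty_gtr.
  by rewrite ler_pdivrMr // mulrC -ler_pdivrMr // ltW //; near: n; exact: nbhs_infty_gtr.
- by rewrite (probability_spacings U_unif U_indep i00 i01 j00 j01).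
apply/eqO_exP; exists 200 => //; near=> n.
rewrite /= (ger0_norm (x := n%:R^-1)) ?invr_ge0 //.
by apply: pq; near: n; exact: nbhs_infty_gt.
Unshelve. all: by end_near. Qed.
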